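(* For every $t\ge 0$ and every complex $z$ with $|z|\le 1$, the probability generating function $P(z,t)=E\big[z^{N(t)}\big]=\sum_{n\ge 0}z^nP(N(t)=n)$ of the number of customers in the system equals $$P(z,t)=\exp\Big(-\nu t-\lambda(1-z)\int_0^t(1-B(x))\,dx\Big)+\nu\int_0^t\exp\Big(-\nu u-\lambda(1-z)\int_0^u(1-B(x))\,dx\Big)\,du .$$
   Context: Model $M|G|\infty$ with catastrophes: customers arrive according to a homogeneous Poisson process with rate $\lambda>0$; catastrophes occur according to an independent homogeneous Poisson process with rate $\nu\ge 0$; service times are i.i.d. with distribution function $B$ on $[0,\infty)$ ($B(x)=P(\beta\le x)$), with finite mean $b_1$, and are independent of the arrival and catastrophe processes. There are infinitely many servers, so every arriving customer starts service immediately and departs when its service ends, unless a catastrophe occurs earlier: at each catastrophe epoch all customers present are removed instantaneously (a catastrophe occurring when the system is empty has no effect). The system is empty at time $0$. $N(t)$ is the number of customers present at time $t\ge 0$. *)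

(* Defs.v *)
From HB Require Import structures.
From mathcomp Require Import all_boot all_order all_algebra.
From mathcomp Require Import all_classical all_reals all_analysis.
From mathcomp Require Import complex.

Set Implicit Arguments.
Unset Strict Implicit.
Unset Printing Implicit Defensive.

Import Order.TTheory GRing.Theory Num.Theory.
Import numFieldNormedType.Exports.
Local Open Scope classical_set_scope.
Local Open Scope ring_scope.
Local Open Scope complex_scope.

Definition mutually_independent {d : measure_display} {Omega : measurableType d}
  {R : realType} (P : probability Omega R) (I : eqType) (Z : I -> Omega -> R) : Prop :=
  forall (s : seq I) (A : I -> set R), uniq s ->
    (forall i, i \in s -> measurable (A i)) ->
    P (\bigcap_(i in [set` s]) (Z i @^-1` A i)) =
    (\prod_(i <- s) P (Z i @^-1` A i))%E.

(** The three i.i.d. families packed into one family indexed by (nat + nat) + nat: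
    arrival interarrival times, catastrophe interarrival times, service times. *)
Definition pack3 {Omega R : Type} (X Y S : nat -> Omega -> R) :
  (nat + nat) + nat -> Omega -> R :=
  fun i => match i with
           | inl (inl k) => X k
           | inl (inr k) => Y k
           | inr k => S k
           end.

Definition epoch {Omega : Type} {R : realType} (X : nat -> Omega -> R)
  (k : nat) (w : Omega) : R := \sum_(i < k.+1) X i w.

(** Customer k (arriving at epoch X k) is present at time t: it has arrived,
    its service has not ended, and no catastrophe occurred in [arrival, t].
    Catastrophes occur only if nu > 0, at the epochs of [Y]. *)
Definition present {Omega : Type} {R : realType} (nu : R)
  (X Y S : nat -> Omega -> R) (t : R) (w : Omega) (k : nat) : Prop :=
  epoch X k w <= t /\ t < epoch X k w + S k w /\
  ~ (0 < nu /\ exists j, epoch X k w <= epoch Y j w <= t).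

Definition N_eq {Omega : Type} {R : realType} (nu : R)
  (X Y S : nat -> Omega -> R) (t : R) (n : nat) : set Omega :=
  [set w | exists s : seq nat, [/\ uniq s, size s = n &
             forall k, present nu X Y S t w k <-> k \in s]].

Definition cre {R : Type} (w : R[i]) : R := let: a +i* _ := w in a.
Definition cim {R : Type} (w : R[i]) : R := let: _ +i* b := w in b.

Definition cexp {R : realType} (w : R[i]) : R[i] :=
  (expR (cre w) * cos (cim w)) +i* (expR (cre w) * sin (cim w)).

Definition cintegral {R : realType} (a b : R) (f : R -> R[i]) : R[i] :=
  (Rintegral lebesgue_measure `[a, b] (fun x => cre (f x))) +i*
  (Rintegral lebesgue_measure `[a, b] (fun x => cim (f x))).

Definition expo {R : realType} (lam nu : R) (B : R -> R) (z : R[i]) (u : R) : R[i] :=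
  (- (nu * u))%:C - (lam * Rintegral lebesgue_measure `[0, u] (fun x => 1 - B x))%:C
                    * (1 - z).

Definition pgf_formula {R : realType} (lam nu : R) (B : R -> R) (z : R[i]) (t : R) : R[i] :=
  cexp (expo lam nu B z t) + nu%:C * cintegral 0 t (fun u => cexp (expo lam nu B z u)).

(* Main.v *)
Require Import Defs.
From HB Require Import structures.
From mathcomp Require Import all_boot all_order all_algebra.
From mathcomp Require Import all_classical all_reals all_analysis.
From mathcomp Require Import complex.
From mathcomp Require Import measurable_realfun ring lra.
Import Order.TTheory GRing.Theory Num.Theory.
Import numFieldNormedType.Exports.
Local Open Scope classical_set_scope.
Local Open Scope ring_scope.

(** Measure time backwards from the horizon [t].  Given the catastrophes, a
customer whose arrival lies [v] before [t] is still present with a probability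
[b v], independently of the others, so the number present is Poisson with mean
[lam * \int_0^t b].  This thinning property comes from conditioning on the first
arrival: the Poisson weights solve the resulting renewal equation, and the
recursion over the number of arrivals taken into account contracts towards that
solution.  Thinning the catastrophe process itself shows that no catastrophe
falls in the last [v] units of time with probability [expR (- (nu * v))], i.e.
the age of the last catastrophe is exponential, cut off at [t].  Averaging the
Poisson weights over this age gives the law of [N(t)], whose generating function
is obtained from the exponential series, uniformly on compact sets. *)

Set Implicit Arguments.
Unset Strict Implicit.
Unset Printing Implicit Defensive.

(** The distribution function [B] is merely monotone, and a catastrophe path enters through an
    indicator, so [b] is only measurable and its integral need not be differentiable everywhere.
    Differentiation in time is therefore replaced by a calculus of Lipschitz functions with bounded
    measurable densities. Conditioning is replaced by Tonelli: a sample point that occurs twice in a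
    nonnegative integrand, through disjoint subfamilies, may be integrated twice independently.
    Truncating to the next [m] arrivals gives an induction that does not presuppose finitely many
    arrivals before the horizon. The remaining time then runs into the negative reals, so the error
    bound [2 ^- m * expR (lam * u)] is proved for every real [u]; its ratio 1/2 is the Laplace
    transform of the exponential law of rate [lam] taken at [lam]. The distribution of the age is
    never constructed as a measure: on each path the age is a threshold, and integrals up to it
    become integrals over [[0, t]] against the indicator of [clear], whose expectation is known. *)

(** * Independence of disjoint subfamilies and the Fubini rule drawn from it *)

Section independence.
Context (R : realType) (d : measure_display) (Omega : measurableType d).
Context (P : probability Omega R) (I : choiceType) (Z : I -> Omega -> R).
Hypothesis mZ : forall i, measurable_fun setT (Z i).
Hypothesis indepZ : mutually_independent P Z.

(** A pi-system generating the sigma-algebra of the [Z i] with [i] in [J]; its members are the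
    finite intersections to which the independence hypothesis applies directly. *)
Definition cylinder (J : pred I) : set (set Omega) :=
  [set A | exists (s : seq I) (F : I -> set R),
    [/\ uniq s, all J s, forall i, measurable (F i) &
        A = \bigcap_(i in [set` s]) (Z i @^-1` F i)]].

Lemma measurable_cylinder J A : cylinder J A -> measurable A.
Proof.
move=> [s [F [_ _ mF ->]]]; rewrite bigcap_seq.
elim/big_ind : _ => // [B C|i _]; first exact: measurableI.
by rewrite -[X in measurable X]setTI; exact: mZ.
Qed.

Lemma cylinderT J : cylinder J setT.
Proof.
by exists [::], (fun=> setT); split => //; rewrite bigcap_seq big_nil.
Qed.

Lemma cylinder_setI J : setI_closed (cylinder J).
Proof.
move=> _ _ [s [F [us Js mF ->]]] [s' [F' [us' Js' mF' ->]]].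
exists (undup (s ++ s')), (fun i => (if i \in s then F i else setT) `&`
                           (if i \in s' then F' i else setT)); split.
- exact: undup_uniq.
- apply/allP => i; rewrite mem_undup mem_cat => /orP[] H.
    by move/allP : Js => /(_ _ H).
  by move/allP : Js' => /(_ _ H).
- by move=> i; apply: measurableI; case: ifP.
- apply/seteqP; split => [w [sw s'w] i /= _|w /= H].
    by split; case: ifPn => // h; [exact: sw|exact: s'w].
  split => i /= h; have := H i; rewrite /= mem_undup mem_cat h ?orbT => /(_ isT).
    by case.
  by case.
Qed.

Lemma cylinder_indep (J J' : pred I) A B : (forall i, J i -> ~~ J' i) ->
  cylinder J A -> cylinder J' B -> P (A `&` B) = (P A * P B)%E.
Proof.
move=> JJ' [s [F [us Js mF ->]]] [s' [F' [us' Js' mF' ->]]].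
have ss' i : i \in s' -> (i \in s) = false.
  move=> h; apply/negP => /(allP Js) /JJ'; move/allP : Js' => /(_ _ h).
  by move=> ->.
rewrite !indepZ//.
have -> : \bigcap_(i in [set` s]) (Z i @^-1` F i)
    `&` \bigcap_(i in [set` s']) (Z i @^-1` F' i)
   = \bigcap_(i in [set` s ++ s'])
       (Z i @^-1` (if i \in s then F i else F' i)).
  apply/seteqP; split => [w [sw s'w] i /=|w /= H].
    by rewrite mem_cat; case: ifPn => h /=; [move=> _; exact: sw|exact: s'w].
  split => i /= h; have := H i; rewrite /= mem_cat h ?orbT => /(_ isT) //.
  by rewrite ss'.
rewrite indepZ; first last.
- by move=> i _; case: ifP.
- rewrite cat_uniq us us' andbT /=; apply/hasPn => i h /=.
  by rewrite ss'.
rewrite big_cat/=; congr (_ * _)%E.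
  by apply: eq_big_seq => i ->.
by apply: eq_big_seq => i /ss' ->.
Qed.

Lemma sigma_cylinder_sub J : <<s cylinder J >> `<=` @measurable _ Omega.
Proof.
apply: smallest_sub; first exact: sigma_algebra_measurable.
by move=> A; exact: measurable_cylinder.
Qed.

(** Both sides are finite measures in [A] that agree on a pi-system, hence on the sigma-algebra it
    generates. One use for each of the two factors gives full independence. *)
Let extend J B : measurable B ->
  (forall A, cylinder J A -> P (A `&` B) = (P A * P B)%E) ->
  (forall A, <<s cylinder J >> A -> P (A `&` B) = (P A * P B)%E).
Proof.
move=> mB H A sA.
have fB : P B \is a fin_num by exact: fin_num_measure.
have PB0 : 0 <= fine (P B) by exact: fine_ge0.
transitivity (mscale (NngNum PB0) P A); last by rewrite /mscale/= fineK// muleC.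
apply: (@g_sigma_algebra_measure_unique _ _ _ (cylinder J)
  (@measurable_cylinder J) (fun=> setT) (fun=> cylinderT J) _
  (mrestr P mB) (mscale (NngNum PB0) P) (@cylinder_setI J)) => //.
- by apply/seteqP; split => // w _; exists 0%N.
- by move=> C cC; rewrite -[LHS]/(P (C `&` B)) H// -[RHS]/((fine (P B))%:E * P C)%E fineK// muleC.
- by move=> _; rewrite -[X in (X < _)%E]/(P (setT `&` B)) setTI ltey_eq fB.
Qed.

Lemma sigma_cylinder_indep (J J' : pred I) A B : (forall i, J i -> ~~ J' i) ->
  <<s cylinder J >> A -> <<s cylinder J' >> B -> P (A `&` B) = (P A * P B)%E.
Proof.
move=> JJ' sA sB; apply: (@extend J) => //; first exact: sigma_cylinder_sub sB.
move=> C cC; rewrite setIC muleC; apply: (@extend J') => //.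
  exact: measurable_cylinder cC.
by move=> E cE; rewrite setIC muleC (cylinder_indep JJ').
Qed.

(** The carrier is still [Omega], with a coarser sigma-algebra: measurability on it expresses
    dependence on the family [J] alone, without building a space of sequences. *)
Definition sub_space (J : pred I) : measurableType (sigma_display (cylinder J)) :=
  g_sigma_algebraType (cylinder J).

Lemma measurable_sub_space (J : pred I) i : J i ->
  measurable_fun [set: sub_space J] (Z i : sub_space J -> R).
Proof.
move=> Ji _ A mA; rewrite setTI; apply: sub_sigma_algebra.
exists [:: i], (fun=> A); split => //=; first by rewrite Ji.
by rewrite bigcap_seq big_seq1.
Qed.

Definition to_sub_space J (w : Omega) : sub_space J := w.

Lemma measurable_to_sub_space J : measurable_fun setT (@to_sub_space J).
Proof. by move=> _ A mA; rewrite setTI; exact: sigma_cylinder_sub mA. Qed.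

HB.instance Definition _ J := @isMeasurableFun.Build _ _ _ _ (@to_sub_space J)
  (@measurable_to_sub_space J).

(* Independence lets the two occurrences of the sample point be integrated
   separately. *)
Lemma indep_fubini (J J' : pred I) (F : sub_space J * sub_space J' -> \bar R) :
  (forall i, J i -> ~~ J' i) -> measurable_fun setT F -> (forall x, 0 <= F x)%E ->
  (\int[P]_w F (w, w) = \int[P]_w \int[P]_w' F (w, w'))%E.
Proof.
move=> JJ' mF F0.
pose dg (w : Omega) := (to_sub_space J w, to_sub_space J' w).
have mdg : measurable_fun setT dg.
  by apply/measurable_fun_pair; exact: measurable_to_sub_space.
pose m1 := distribution P (@to_sub_space J).
pose m2 := distribution P (@to_sub_space J').
(* The diagonal pulls a rectangle [A * B] back to the intersection of [A] and [B], so independence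
   makes the law of the diagonal map a product measure. *)
have mmE X : measurable X -> (m1 \x m2)%E X = pushforward P dg X.
  move=> mX; apply: (product_measure_unique (m' := pushforward P dg)) => //.
  by move=> A B mA mB; exact: sigma_cylinder_indep JJ' mA mB.
transitivity (\int[pushforward P dg]_x F x)%E.
  by rewrite ge0_integral_pushforward.
transitivity (\int[m1 \x m2]_x F x)%E.
  by apply: eq_measure_integral => A mA _; exact/esym/mmE.
rewrite fubini_tonelli1// ge0_integral_distribution//; first last.
- by move=> x; apply: integral_ge0.
- exact: measurable_fun_fubini_tonelli_F.
apply: eq_integral => w _ /=; rewrite /fubini_F ge0_integral_distribution//.
exact: measurableT_comp.
Qed.
End independence.

(** * The exponential law: from the distribution function to a density in reversed time *)

Section exponential_law.
Context (R : realType).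
Local Notation mu := (@lebesgue_measure R).

Lemma exponential_prob_le (lam x : R) : 0 < lam ->
  exponential_prob lam `]-oo, x] =
  (if 0 <= x then 1 - expR (- (lam * x)) else 0)%:E.
Proof.
move=> lam0.
have -> : exponential_prob lam `]-oo, x] = exponential_prob lam `[0, x].
  rewrite /exponential_prob [LHS]integral_mkcond [RHS]integral_mkcond.
  apply: eq_integral => y _; rewrite !patchE.
  have [y0|y0] := ltP y 0.
    by rewrite lt0_exponential_pdf//; do 2 case: ifP.
  by congr (if _ then _ else _); apply: asbool_equiv_eq; rewrite /= !in_itv/= y0.
case: ifPn => [|x0].
  rewrite le_eqVlt => /predU1P[<-|x0].
    rewrite mulr0 oppr0 expR0 subrr /exponential_prob set_itv1 integral_set1//.
  by rewrite exponential_prob_itv0c// mulNr.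
by rewrite /exponential_prob set_itv_ge ?integral_set0// bnd_simp.
Qed.

(** The rays []x, +oo[] are stable under intersection and generate the Borel sets; on them the two
    measures are complements of the distribution functions. *)
Lemma exponential_law d (Omega : measurableType d) (P : probability Omega R)
    (lam : R) (X : Omega -> R) : 0 < lam -> measurable_fun setT X ->
  (forall x : R, P [set w | X w <= x] =
     (if 0 <= x then 1 - expR (- (lam * x)) else 0)%:E) ->
  forall A, measurable A -> pushforward P X A = exponential_prob lam A.
Proof.
move=> lam0 mX cdfX A mA.
pose m1 : {measure set (measurableTypeR R) -> \bar R} :=
  pushforward P (X : _ -> measurableTypeR R).
pose m2 : probability (measurableTypeR R) R := exponential_prob lam.
suff : forall A : set (measurableTypeR R), measurable A -> m1 mX A = m2 lam0 A.
  exact.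
apply: (@measure_unique _ _ (measurableTypeR R) (@RGenOInfty.G R)
  (fun k => `](- k%:R), +oo[%classic) (@RGenOInfty.measurableE R) _ _ _
  (m1 mX) (m2 lam0)) => //.
- move=> _ _ [x ->] [y ->]; exists (Num.max x y).
  by apply/seteqP; split => z; rewrite /= !in_itv/= !andbT gt_max => /andP.
- by move=> k; exists (- k%:R).
- apply/seteqP; split => // x _; exists (Num.bound `|x|) => //=.
  rewrite in_itv/= andbT ltrNl (le_lt_trans (ler_norm _))// normrN.
  exact: archi_boundP.
- move=> _ [x ->]; rewrite -setCitvl [RHS]probability_setC//.
  rewrite -[LHS]/(P (~` (X @^-1` `]-oo, x]))) probability_setC; last first.
    by rewrite -[X in measurable X]setTI; exact: mX.
  rewrite -[X in _ = (1 - X)%E]/(exponential_prob lam `]-oo, x]).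
  rewrite exponential_prob_le// -cdfX.
  have -> // : X @^-1` `]-oo, x]%classic = [set w | X w <= x].
  by apply/seteqP; split => w; rewrite /= in_itv.
- move=> k; apply: (@le_lt_trans _ _ 1%E); last exact: ltry.
  apply: probability_le1; rewrite -[X in measurable X]setTI; exact: mX.
Qed.

(** The function [f] and the Radon-Nikodym derivative have the same integral over every measurable
    set, hence agree almost everywhere, and the change of variables for the derivative carries over
    to [f]. *)
Lemma ge0_integral_density (nu : {finite_measure set (measurableTypeR R) -> \bar R})
    (f : R -> R) (g : R -> \bar R) :
  measurable_fun setT f -> (forall x, 0 <= f x) ->
  (forall A, measurable A -> nu A = \int[mu]_(x in A) (f x)%:E)%E ->
  measurable_fun setT g -> (forall x, 0 <= g x)%E ->
  (\int[nu]_x g x = \int[mu]_x (g x * (f x)%:E))%E.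
Proof.
move=> mf f0 nuE mg g0.
have dom : nu `<< mu.
  apply/null_content_dominatesP => A mA muA; rewrite nuE//.
  by apply: null_set_integral => //; exact/measurable_EFinP/measurable_funTS.
have mEf : measurable_fun setT (EFin \o f) by exact/measurable_EFinP.
have iRN := Radon_Nikodym_SigmaFinite.f_integrable dom.
rewrite -(Radon_Nikodym_SigmaFinite.change_of_variables dom)//.
apply: ae_eq_integral => //.
- by apply: emeasurable_funM => //; exact: measurable_int iRN.
- exact: emeasurable_funM.
- apply: ae_eqe_mul2l; apply: integral_ae_eq => //.
  by move=> A _ mA; rewrite -Radon_Nikodym_SigmaFinite.f_integral// nuE.
Qed.

Lemma lebesgue_measure_reflect (u : R) (A : set R) : measurable A ->
  pushforward mu (fun x : R => u - x : measurableTypeR R) A = mu A.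
Proof.
move=> mA.
have mr : measurable_fun setT (fun x : R => u - x : measurableTypeR R).
  exact: measurable_funB.
apply/esym/lebesgue_measure_unique => //= _ [[a b]] _ <-.
rewrite /pushforward.
have -> : (fun x : R => u - x) @^-1` `]a, b] = `[u - b, u - a[%classic.
  by apply/seteqP; split => x; rewrite /= !in_itv/= => /andP[? ?]; apply/andP; split; lra.
rewrite !lebesgue_measure_itv/= !lte_fin.
have -> : (u - b < u - a) = (a < b) by apply/idP/idP; lra.
by case: ifP => // _; congr (_%:E); ring.
Qed.

Lemma ge0_integral_reflect (u : R) (h : R -> \bar R) :
  measurable_fun setT h -> (forall x, 0 <= h x)%E ->
  (\int[mu]_x h (u - x)%R = \int[mu]_x h x)%E.
Proof.
move=> mh h0.
pose r (x : measurableTypeR R) : measurableTypeR R := u - x.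
have mr : measurable_fun setT r by exact: measurable_funB.
have h0' : {in [set: measurableTypeR R], forall y, (0 <= h y)%E} by [].
have := @ge0_integral_pushforward _ _ (measurableTypeR R) _ R r mr mu setT h measurableT mh h0'.
rewrite preimage_setT => <-; apply: eq_measure_integral => A mA _.
exact: lebesgue_measure_reflect.
Qed.

(** The quantity [u - X w] is the time left to horizon [u] after an interarrival time; it is
    negative when the arrival falls beyond the horizon, hence the range down to [-oo]. *)
Lemma exponential_law_reflect d (Omega : measurableType d) (P : probability Omega R)
    (lam : R) (X : Omega -> R) : 0 < lam -> measurable_fun setT X ->
  (forall x : R, P [set w | X w <= x] =
     (if 0 <= x then 1 - expR (- (lam * x)) else 0)%:E) ->
  forall (u : R) (g : R -> \bar R), measurable_fun setT g -> (forall x, 0 <= g x)%E ->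
  (\int[P]_w g (u - X w)%R = \int[mu]_(v in `]-oo, u])
     (g v * (lam * expR (- (lam * (u - v))))%:E))%E.
Proof.
move=> lam0 mX cdfX u g mg g0.
pose m2 : probability (measurableTypeR R) R := exponential_prob lam.
have mgu : measurable_fun setT (fun x : R => g (u - x)).
  by apply: measurableT_comp => //; exact: measurable_funB.
transitivity (\int[pushforward P (X : _ -> measurableTypeR R)]_x g (u - x)%R)%E.
  by rewrite ge0_integral_pushforward.
transitivity (\int[m2 lam0]_x g (u - x)%R)%E.
  by apply: eq_measure_integral => A mA _; exact: exponential_law cdfX _ _.
rewrite (@ge0_integral_density _ (exponential_pdf lam))//; last 2 first.
- exact: measurable_exponential_pdf.
- by move=> x; exact: exponential_pdf_ge0 (ltW lam0) x.
rewrite -(@ge0_integral_reflect u) /=; last 2 first.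
- apply: emeasurable_funM => //; apply/measurable_EFinP.
  exact: measurable_exponential_pdf.
- by move=> x; rewrite mule_ge0// lee_fin exponential_pdf_ge0// ltW.
under eq_integral do rewrite subKr.
rewrite [RHS]integral_mkcond; apply: eq_integral => v _; rewrite patchE.
case: ifPn; rewrite ?inE ?notin_setE/= in_itv/=.
  by move=> vu; rewrite exponential_pdfE ?subr_ge0// mulNr.
by move=> /negP; rewrite -ltNge => uv; rewrite lt0_exponential_pdf ?mule0// subr_lt0.
Qed.

End exponential_law.

(** * Chain and product rules for Lipschitz functions with bounded measurable densities *)

Section absolute_continuity.
Context (R : realType).
Local Notation mu := (@lebesgue_measure R).
Implicit Types (a b x y : R) (F f G g : R -> R).

Lemma bounded_integrable_itv f x y C : measurable_fun setT f ->
  (forall v, x <= v <= y -> `|f v| <= C) -> mu.-integrable `[x, y] (EFin \o f).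
Proof.
move=> mf bf; apply: measurable_bounded_integrable => //=.
- by rewrite lebesgue_measure_itv/=; case: ifP => _; rewrite ltry.
- exact: measurable_funTS.
- exists C; split => [|M CM v /=]; first exact: num_real.
   rewrite in_itv/= => /bf /le_trans; apply.
  exact: ltW.
Qed.

Lemma Rintegral_itv_cat f x y z : x <= y -> y <= z ->
  mu.-integrable `[x, z] (EFin \o f) ->
  \int[mu]_(v in `[x, z]) f v =
  \int[mu]_(v in `[x, y]) f v + \int[mu]_(v in `[y, z]) f v.
Proof.
move=> xy yz fi; have := @Rintegral_itvB R f (BLeft x) (BRight z) y fi.
rewrite !bnd_simp => /(_ xy yz) => /eqP; rewrite subr_eq addrC => /eqP ->.
rewrite Rintegral_itv_obnd_cbnd//.
by apply: integrableS fi => //; apply: subset_itvr; rewrite bnd_simp.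
Qed.

Lemma norm_Rintegral_le f x y C : x <= y -> measurable_fun setT f ->
  (forall v, x <= v <= y -> `|f v| <= C) ->
  `|\int[mu]_(v in `[x, y]) f v| <= C * (y - x).
Proof.
move=> xy mf bf; have fi := bounded_integrable_itv mf bf.
apply: (le_trans (le_normr_Rintegral _ fi)) => //.
have -> : C * (y - x) = \int[mu]_(v in `[x, y]) (cst C v).
  rewrite Rintegral_cst//= lebesgue_measure_itv/= lte_fin.
  move: xy; rewrite le_eqVlt => /predU1P[->|->]//=.
  by rewrite ltxx subrr mulr0.
apply: le_Rintegral => //.
- exact: integrable_norm fi.
- by apply: (@bounded_integrable_itv _ _ _ `|C|) => //.
Qed.

(** A substitute for [f] being the derivative of [F] on [[a, b]] when [f] is only measurable. The
    bound on [f] makes [F] Lipschitz, which is what turns the error terms of the rules below into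
    quadratic ones. *)
Definition indef_integral a b F f : Prop :=
  [/\ measurable_fun setT F, measurable_fun setT f,
      exists2 C, 0 <= C & forall x, a <= x <= b -> `|f x| <= C &
      forall x y, a <= x -> x <= y -> y <= b ->
        F y - F x = \int[mu]_(v in `[x, y]) f v].

Lemma indef_integral_lip a b F f : indef_integral a b F f ->
  exists2 C, 0 <= C & forall x y, a <= x <= b -> a <= y <= b ->
    `|F y - F x| <= C * `|y - x|.
Proof.
move=> [mF mf [C C0 bf] Ff]; exists C => // x y.
wlog xy : x y / x <= y => [H hx hy|/andP[ax xb] /andP[ay yb]].
  by have [/H|/ltW/H] := leP x y; [exact|rewrite distrC [`|_ - x|]distrC; exact].
rewrite Ff// [`|y - x|]ger0_norm ?subr_ge0//; apply: norm_Rintegral_le => //.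
by move=> v /andP[xv vy]; apply: bf; rewrite (le_trans ax xv) (le_trans vy yb).
Qed.

Lemma indef_integral_bounded a b F f : indef_integral a b F f ->
  exists2 C, 0 <= C & forall x, a <= x <= b -> `|F x| <= C.
Proof.
move=> /indef_integral_lip[C C0 lF].
exists (`|F a| + C * `|b - a|) => [|x /andP[ax xb]].
  by rewrite addr_ge0// mulr_ge0.
have ab := le_trans ax xb.
rewrite -[F x](subrK (F a)) addrC (le_trans (ler_normD _ _))// lerD2l.
apply: (le_trans (lF _ _ _ _)); rewrite ?lexx ?ax ?xb ?ab//.
rewrite ler_wpM2l// !ger0_norm ?subr_ge0//; exact: lerB.
Qed.

(** Cutting [[a, b]] into [n.+1] equal pieces bounds the total increment by
    [C * (b - a) ^+ 2 / n.+1%:R], which is arbitrarily small. *)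
Lemma quadratic_const (D : R -> R) a b C : a <= b ->
  (forall x y, a <= x -> x <= y -> y <= b -> `|D y - D x| <= C * (y - x) ^+ 2) ->
  D b = D a.
Proof.
move=> ab H; apply/eqP; rewrite -subr_eq0 -normr_le0; apply/ler_addgt0Pl => e e0.
rewrite addr0.
have H' (n : nat) : `|D b - D a| <= C * (b - a) ^+ 2 / n.+1%:R.
  pose h := (b - a) / n.+1%:R.
  have h0 : 0 <= h by rewrite divr_ge0// subr_ge0.
  have hn : h *+ n.+1 = b - a by rewrite -mulr_natr /h divfK.
  have hk k : (k <= n.+1)%N -> `|D (a + h *+ k) - D a| <= C * h ^+ 2 *+ k.
    elim: k => [_|k IH kn]; first by rewrite !mulr0n addr0 subrr normr0.
    rewrite -[X in `|X|](subrKA (D (a + h *+ k))) [leRHS]mulrSr.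
    rewrite (le_trans (ler_normD _ _))// addrC lerD ?IH// 1?ltnW//.
    apply: (le_trans (H _ _ _ _ _)).
    - by rewrite lerDl mulrn_wge0.
    - by rewrite lerD2l mulrSr lerDl.
    - by rewrite -lerBrDl -hn ler_wpMn2l.
    - by rewrite mulrSr addrA [a + _ + _]addrC addrK.
  have := hk n.+1 (leqnn _); rewrite hn [a + _]addrC subrK => /le_trans; apply.
  rewrite /h -mulr_natr le_eqVlt; apply/orP; left; apply/eqP.
  by field; rewrite addrC natr1.
set c := C * (b - a) ^+ 2 in H'.
apply: (le_trans (H' (Num.bound `|c / e|))).
rewrite ler_pdivrMr// mulrC -ler_pdivrMr//.
rewrite (le_trans (ler_norm _))// (le_trans (ltW (archi_boundP _)))//.
by rewrite ler_nat.
Qed.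

(** The difference between [H] and the running integral of [h] has quadratically small increments,
    so [quadratic_const] makes it constant. Checking a density thus reduces to a local estimate. *)
Lemma indef_integral_crit a b (H h : R -> R) : measurable_fun setT H -> measurable_fun setT h ->
  (exists2 C, 0 <= C & forall x, a <= x <= b -> `|h x| <= C) ->
  (exists C, forall x y, a <= x -> x <= y -> y <= b ->
     `|H y - H x - \int[mu]_(v in `[x, y]) h v| <= C * (y - x) ^+ 2) ->
  indef_integral a b H h.
Proof.
move=> mH mh bh [C HC]; split => // x y ax xy yb.
have [K _ bK] := bh.
have hi z z' : x <= z -> z' <= y -> mu.-integrable `[z, z'] (EFin \o h).
  move=> xz zy; apply: (@bounded_integrable_itv _ _ _ K) => // v /andP[zv vz].
  by apply: bK; rewrite (le_trans ax)// ?(le_trans xz)// (le_trans vz)// (le_trans zy).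
pose D z := H z - \int[mu]_(v in `[x, z]) h v.
have := @quadratic_const D x y C xy.
rewrite /D set_itv1 Rintegral_set1 subr0 => DE.
apply/eqP; rewrite subr_eq addrC -subr_eq; apply/eqP; apply: DE.
move=> z z' xz zz' zy; rewrite (@Rintegral_itv_cat h x z z')// ?hi//.
apply: le_trans (HC _ _ _ zz' _); last 2 first.
- exact: le_trans xz.
- exact: le_trans yb.
by rewrite le_eqVlt; apply/orP; left; apply/eqP; congr `|_|; ring.
Qed.

(** The local error has two parts, each quadratic because [F] is Lipschitz: the Taylor remainder of
    [Phi], and the variation of [dPhi (F v)] over [[x, y]] integrated against [f]. The bounds on
    [Phi] and [dPhi] are asked only at values of [F], since the Poisson weights are controlled only
    on the nonnegative half-line. *)
Lemma indef_integral_comp a b F f (Phi dPhi : R -> R) (K : R) : indef_integral a b F f ->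
  measurable_fun setT Phi -> measurable_fun setT dPhi -> 0 <= K ->
  (forall x, a <= x <= b -> `|dPhi (F x)| <= K) ->
  (forall x y, a <= x <= b -> a <= y <= b ->
    `|dPhi (F y) - dPhi (F x)| <= K * `|F y - F x|) ->
  (forall x y, a <= x <= b -> a <= y <= b ->
    `|Phi (F y) - Phi (F x) - dPhi (F x) * (F y - F x)| <= K * `|F y - F x| ^+ 2) ->
  indef_integral a b (Phi \o F) (fun v => dPhi (F v) * f v).
Proof.
move=> iF mPhi mdPhi K0 bdP ldP tP; have [mF mf [C C0 bf] Ff] := iF.
have [L L0 lF] := indef_integral_lip iF.
have mdF : measurable_fun setT (dPhi \o F) by exact: measurableT_comp.
apply: indef_integral_crit.
- exact: measurableT_comp.
- exact: measurable_funM.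
- exists (K * C); first exact: mulr_ge0.
  by move=> x xab; rewrite normrM ler_pM// ?bdP ?bf.
exists (K * L ^+ 2 + K * L * C) => x y ax xy yb.
have xab v : x <= v <= y -> a <= v <= b.
  by move=> /andP[xv vy]; rewrite (le_trans ax xv) (le_trans vy yb).
have [xab1 yab] : a <= x <= b /\ a <= y <= b by split; apply: xab; rewrite lexx xy.
have fi : mu.-integrable `[x, y] (EFin \o f).
  by apply: (@bounded_integrable_itv _ _ _ C) => // v /xab/bf.
have dfi : mu.-integrable `[x, y] (EFin \o (fun v => dPhi (F v) * f v)).
  apply: (@bounded_integrable_itv _ _ _ (K * C)); first exact: measurable_funM.
  by move=> v /xab vab; rewrite normrM ler_pM// ?bdP ?bf.
have -> : (Phi \o F) y - (Phi \o F) x - \int[mu]_(v in `[x, y]) (dPhi (F v) * f v) =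
   (Phi (F y) - Phi (F x) - dPhi (F x) * (F y - F x)) +
   \int[mu]_(v in `[x, y]) (dPhi (F x) * f v - dPhi (F v) * f v).
  rewrite RintegralB//; last first.
    apply: (@bounded_integrable_itv _ _ _ (K * C)); first exact: measurable_funM.
    by move=> v /xab vab; rewrite normrM ler_pM// ?bdP ?bf.
  by rewrite RintegralZl// -Ff//=; ring.
rewrite mulrDl (le_trans (ler_normD _ _))// lerD//.
  rewrite (le_trans (tP _ _ _ _))// -mulrA ler_wpM2l// -exprMn ler_sqr ?nnegrE//.
  - by rewrite (le_trans (lF _ _ _ _))// ger0_norm// subr_ge0.
  - by rewrite mulr_ge0// subr_ge0.
apply: (@le_trans _ _ (K * L * C * (y - x) * (y - x))); last by rewrite expr2 mulrA.
apply: norm_Rintegral_le => //.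
  by apply: measurable_funB; exact: measurable_funM.
move=> v vxy; rewrite -mulrBl normrM mulrAC ler_pM//; last by rewrite bf// xab.
rewrite distrC (le_trans (ldP _ _ _ _))// ?xab// -mulrA ler_wpM2l//.
rewrite (le_trans (lF _ _ _ _))// ?xab// ler_wpM2l//.
by move/andP : vxy => [xv vy]; rewrite ger0_norm ?subr_ge0// lerB.
Qed.

Lemma indef_integral_mul a b F f G g :
  indef_integral a b F f -> indef_integral a b G g ->
  indef_integral a b (fun v => F v * G v) (fun v => f v * G v + F v * g v).
Proof.
move=> iF iG; have [mF mf [C C0 bf] Ff] := iF; have [mG mg [C' C'0 bg] Gg] := iG.
have [L L0 lF] := indef_integral_lip iF.
have [L' L'0 lG] := indef_integral_lip iG.
have [K K0 bF] := indef_integral_bounded iF.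
have [K' K'0 bG] := indef_integral_bounded iG.
have b1 v : a <= v <= b -> `|f v * G v| <= C * K'.
  by move=> vab; rewrite normrM ler_pM// ?bf ?bG.
have b2 v : a <= v <= b -> `|F v * g v| <= K * C'.
  by move=> vab; rewrite normrM ler_pM// ?bF ?bg.
apply: indef_integral_crit.
- exact: measurable_funM.
- by apply: measurable_funD; exact: measurable_funM.
- exists (C * K' + K * C'); first by rewrite addr_ge0// mulr_ge0.
  by move=> x xab; rewrite (le_trans (ler_normD _ _))// lerD// ?b1 ?b2.
exists (C * L' + L * C') => x y ax xy yb.
have xab v : x <= v <= y -> a <= v <= b.
  by move=> /andP[xv vy]; rewrite (le_trans ax xv) (le_trans vy yb).
have [xab1 yab] : a <= x <= b /\ a <= y <= b by split; apply: xab; rewrite lexx xy.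
have fi : mu.-integrable `[x, y] (EFin \o f).
  by apply: (@bounded_integrable_itv _ _ _ C) => // v /xab/bf.
have gi : mu.-integrable `[x, y] (EFin \o g).
  by apply: (@bounded_integrable_itv _ _ _ C') => // v /xab/bg.
have i1 : mu.-integrable `[x, y] (EFin \o (fun v => f v * G v)).
  apply: (@bounded_integrable_itv _ _ _ (C * K')); first exact: measurable_funM.
  by move=> v /xab/b1.
have i2 : mu.-integrable `[x, y] (EFin \o (fun v => F v * g v)).
  apply: (@bounded_integrable_itv _ _ _ (K * C')); first exact: measurable_funM.
  by move=> v /xab/b2.
have m1 : measurable_fun setT (fun v => f v * (G y - G v)).
  by apply: measurable_funM => //; exact: measurable_funB.
have m2 : measurable_fun setT (fun v => (F x - F v) * g v).
  by apply: measurable_funM => //; exact: measurable_funB.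
have c1 v : x <= v <= y -> `|f v * (G y - G v)| <= C * (L' * (y - x)).
  move=> vxy; rewrite normrM ler_pM// ?bf ?xab//.
  rewrite (le_trans (lG _ _ _ _))// ?xab// ler_wpM2l//.
  by move/andP : vxy => [xv vy]; rewrite ger0_norm ?subr_ge0// lerB.
have c2 v : x <= v <= y -> `|(F x - F v) * g v| <= L * (y - x) * C'.
  move=> vxy; rewrite normrM ler_pM// ?bg ?xab//.
  rewrite distrC (le_trans (lF _ _ _ _))// ?xab// ler_wpM2l//.
  by move/andP : vxy => [xv vy]; rewrite ger0_norm ?subr_ge0// lerB.
(* Freezing [G] at the right end and [F] at the left end makes the boundary terms telescope; what
   remains is two integrals whose integrands are of order [y - x]. *)
have -> : F y * G y - F x * G x - \int[mu]_(v in `[x, y]) (f v * G v + F v * g v) =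
   \int[mu]_(v in `[x, y]) (f v * (G y - G v)) +
   \int[mu]_(v in `[x, y]) ((F x - F v) * g v).
  rewrite RintegralD//.
  under [X in _ = X + _]eq_Rintegral do rewrite mulrBr.
  under [X in _ = _ + X]eq_Rintegral do rewrite mulrBl.
  rewrite !RintegralB//; last 2 first.
  - apply: (@bounded_integrable_itv _ _ _ (`|F x| * C')); first exact: measurable_funM.
    by move=> v /xab vab; rewrite normrM ler_pM// bg.
  - apply: (@bounded_integrable_itv _ _ _ (C * `|G y|)); first exact: measurable_funM.
    by move=> v /xab vab; rewrite normrM ler_pM// bf.
  by rewrite RintegralZl// RintegralZr// -Ff// -Gg//; ring.
rewrite (le_trans (ler_normD _ _))//.
have -> : (C * L' + L * C') * (y - x) ^+ 2 =
  C * (L' * (y - x)) * (y - x) + L * (y - x) * C' * (y - x) by ring.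
by apply: lerD; exact: norm_Rintegral_le.
Qed.

End absolute_continuity.

(** * Poisson weights as functions of the mean *)

Section poisson_weights.
Context (R : realType).
Implicit Types (n : nat) (u v x y : R).

Definition pois n v : R := expR (- v) * v ^+ n / n`!%:R.

(** With the value 0 at [n = 0], the formula [dpois] for the derivative is uniform in [n]. *)
Definition pois_pred n v : R := if n is m.+1 then pois m v else 0.

Definition dpois n v : R := pois_pred n v - pois n v.

Lemma pois0 n : pois n 0 = (n == 0%N)%:R.
Proof.
rewrite /pois oppr0 expR0 mul1r expr0n; case: n => [|n] /=.
  by rewrite fact0 divr1.
by rewrite mul0r.
Qed.

Lemma pois_exp v : pois 0 v = expR (- v).
Proof. by rewrite /pois expr0 fact0 divr1 mulr1. Qed.

Lemma pois_ge0 n v : 0 <= v -> 0 <= pois n v.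
Proof. by move=> v0; rewrite /pois !mulr_ge0 ?invr_ge0 ?exprn_ge0 ?expR_ge0. Qed.

(** For nonnegative [v], [v ^+ n / n!] is a single term of the series of [expR v]. *)
Lemma pois_le1 n v : 0 <= v -> pois n v <= 1.
Proof.
move=> v0; rewrite /pois -mulrA mulrC expRN ler_pdivrMr ?expR_gt0// mul1r.
have [->|n0] := posnP n; first by rewrite expr0 fact0 divr1 -expR0 ler_expR.
case: n n0 => // n _; apply: le_trans (expR_ge1Dxn n v0).
by rewrite lerDr.
Qed.

Lemma pois_pred_ge0 n v : 0 <= v -> 0 <= pois_pred n v.
Proof. by case: n => //= n; exact: pois_ge0. Qed.

Lemma pois_pred_le1 n v : 0 <= v -> pois_pred n v <= 1.
Proof. by case: n => //= n; exact: pois_le1. Qed.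

Lemma is_derive_pois n v : is_derive v 1 (pois n) (dpois n v).
Proof.
have d1 : is_derive v 1 (fun x : R => expR (- x)) (- expR (- v)).
  by apply: is_derive_eq; rewrite mulrN1.
have d2 : is_derive v 1 (fun x : R => x ^+ n) (n%:R * v ^+ n.-1).
  have := @is_deriveX _ _ id n v 1 1 (is_derive_id v 1).
  rewrite /GRing.scale/= mulr1; congr (is_derive _ _ _ _).
  by apply/funext => x; rewrite fctE.
have -> : pois n = n`!%:R^-1 \*: ((fun x : R => expR (- x)) * (fun x : R => x ^+ n)).
  by apply/funext => x; rewrite /pois !fctE /GRing.scale/= mulrC.
apply: is_derive_eq; rewrite /GRing.scale/= /dpois /pois_pred /pois.
case: n {d2} => [|n]; first by rewrite !mul0r mulr0 add0r expr0 fact0; ring.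
rewrite factS natrM /=; field.
by rewrite addrC natr1 !pnatr_eq0 -lt0n fact_gt0.
Qed.

(** Stated for [x] and [y] in either order, because the chain rule compares arbitrary pairs of
    points. *)
Lemma pois_MVT n x y : 0 <= x -> 0 <= y -> exists c,
  [/\ 0 <= c, `|c - x| <= `|y - x| & pois n y - pois n x = dpois n c * (y - x)].
Proof.
have cont (i : interval R) : {within [set` i], continuous (pois n)}.
  apply: derivable_within_continuous => z _.
  by have [] := is_derive_pois n z.
move=> x0 y0; have [xy|/ltW yx] := leP x y.
  have [c + ->] := MVT_segment xy (fun z _ => is_derive_pois n z) (cont _).
  rewrite in_itv/= => /andP[xc cy]; exists c; split => //; first exact: le_trans xc.
  by rewrite !ger0_norm ?subr_ge0// lerB.
have [c + h] := MVT_segment yx (fun z _ => is_derive_pois n z) (cont _).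
rewrite in_itv/= => /andP[yc cx]; exists c; split; first exact: le_trans yc.
  by rewrite ![`|_ - x|]distrC !ger0_norm ?subr_ge0// lerB.
by rewrite -[LHS]opprB h; ring.
Qed.

Lemma dpois_le1 n v : 0 <= v -> `|dpois n v| <= 1.
Proof.
move=> v0; rewrite /dpois ler_norml.
have := pois_ge0 n v0; have := pois_le1 n v0.
have := pois_pred_ge0 n v0; have := pois_pred_le1 n v0.
by move=> *; apply/andP; split; lra.
Qed.

Lemma pois_lip n x y : 0 <= x -> 0 <= y -> `|pois n y - pois n x| <= `|y - x|.
Proof.
move=> x0 y0; have [c [c0 _ ->]] := pois_MVT n x0 y0.
by rewrite normrM ler_piMl// dpois_le1.
Qed.

Lemma dpois_lip n x y : 0 <= x -> 0 <= y ->
  `|dpois n y - dpois n x| <= 2 * `|y - x|.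
Proof.
move=> x0 y0; rewrite /dpois opprB addrACA mulr2n mulrDl mul1r.
rewrite [X in `|X|](_ : _ = (pois_pred n y - pois_pred n x) - (pois n y - pois n x)); last by ring.
rewrite (le_trans (ler_normB _ _))// lerD ?pois_lip//.
by case: n => [|n] /=; rewrite ?subrr ?normr0// pois_lip.
Qed.

Lemma pois_taylor n x y : 0 <= x -> 0 <= y ->
  `|pois n y - pois n x - dpois n x * (y - x)| <= 2 * `|y - x| ^+ 2.
Proof.
move=> x0 y0; have [c [c0 cx ->]] := pois_MVT n x0 y0.
rewrite -mulrBl normrM expr2 mulrA ler_wpM2r//.
by rewrite (le_trans (dpois_lip _ _ _))// ler_wpM2l.
Qed.

Lemma measurable_pois n : measurable_fun setT (pois n).
Proof.
apply: measurable_funM => //; apply: measurable_funM => //.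
apply: measurableT_comp; first exact: measurable_expR.
exact: measurable_funN.
Qed.

Lemma measurable_pois_pred n : measurable_fun setT (pois_pred n).
Proof. by case: n => [|n]; [exact: measurable_cst|exact: (measurable_pois n)]. Qed.

Lemma indef_integral_pois (a b : R) (F f : R -> R) n : indef_integral a b F f ->
  (forall x, a <= x <= b -> 0 <= F x) ->
  indef_integral a b (pois n \o F) (fun v => dpois n (F v) * f v).
Proof.
(* The constant 2 is the Lipschitz constant of [dpois], a difference of two 1-Lipschitz functions;
   it also covers the bound 1 on [dpois] and the Taylor remainder. *)
move=> iF F0; apply: (@indef_integral_comp _ _ _ _ _ _ _ 2) => //.
- exact: measurable_pois.
- by apply: measurable_funB; [exact: measurable_pois_pred|exact: measurable_pois].
- by move=> x /F0 Fx; rewrite (le_trans (dpois_le1 _ _))// ler1n.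
- by move=> x y /F0 Fx /F0 Fy; exact: dpois_lip.
- by move=> x y /F0 Fx /F0 Fy; exact: pois_taylor.
Qed.

End poisson_weights.

(** * The Poisson weights as a fixed point of conditioning on the first arrival *)

Section renewal_equation.
Context (R : realType).
Local Notation mu := (@lebesgue_measure R).

(** Once the factor [expR (- (lam * (u - c)))] is pulled out, the rest is the total mass of the
    exponential density reflected about [c]. *)
Lemma integral_exp_tail (lam u c : R) : 0 < lam ->
  (\int[mu]_(v in `]-oo, c]) (lam * expR (- (lam * (u - v))))%:E =
   (expR (- (lam * (u - c))))%:E)%E.
Proof.
move=> lam0.
have pdf0 v : 0 <= exponential_pdf lam v by exact: exponential_pdf_ge0 (ltW _) _.
transitivity (\int[mu]_(v in `]-oo, c])
    ((expR (- (lam * (u - c))))%:E * (lam * expR (- (lam * (c - v))))%:E))%E.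
  apply: eq_integral => v _; rewrite -EFinM mulrCA -expRD.
  by congr (_ * expR _)%:E; ring.
rewrite ge0_integralZl//=; last 2 first.
- apply/measurable_EFinP; apply: measurable_funTS; apply: measurable_funM => //.
  apply: measurableT_comp; first exact: measurable_expR.
  apply: measurable_funN; apply: measurable_funM => //; exact: measurable_funB.
- by move=> v _; rewrite lee_fin mulr_ge0 ?expR_ge0 ?ltW.
rewrite [X in (_ * X)%E](_ : _ = 1%E) ?mule1//.
rewrite -(integral_exponential_pdf lam0) -(@ge0_integral_reflect _ c (EFin \o exponential_pdf lam)); last 2 first.
- by apply/measurable_EFinP; exact: measurable_exponential_pdf.
- by move=> v; rewrite lee_fin.
rewrite integral_mkcond; apply: eq_integral => v _; rewrite patchE.
case: ifPn; rewrite ?inE ?notin_setE/= in_itv/=.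
  by move=> vc; rewrite exponential_pdfE ?subr_ge0// mulNr.
by move=> /negP; rewrite -ltNge => cv; rewrite lt0_exponential_pdf// subr_lt0.
Qed.

Variables (lam : R) (b : R -> R).
Hypothesis lam0 : 0 < lam.
Hypothesis mb : measurable_fun setT b.
Hypothesis b01 : forall v, 0 <= b v <= 1.
Hypothesis bneg : forall v, v < 0 -> b v = 0.

Definition thinned_mean (u : R) : R := lam * \int[mu]_(v in `[0, u]) b v.

Local Notation L := thinned_mean.

Let b0 v : 0 <= b v. Proof. by have /andP[] := b01 v. Qed.
Let b1 v : b v <= 1. Proof. by have /andP[] := b01 v. Qed.
Let normb v : `|b v| <= 1. Proof. by rewrite ger0_norm. Qed.

Lemma thinned_mean_ge0 u : 0 <= L u.
Proof. by rewrite mulr_ge0 ?(ltW lam0)//; apply: Rintegral_ge0 => v _. Qed.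

(** Beyond the horizon the mean vanishes, so the weight at [L u] becomes the point mass at [n = 0]:
    the boundary value of the renewal equation. *)
Lemma thinned_mean_neg u : u <= 0 -> L u = 0.
Proof.
rewrite /thinned_mean le_eqVlt => /predU1P[->|u0].
  by rewrite set_itv1 Rintegral_set1 mulr0.
by rewrite set_itv_ge ?Rintegral_set0 ?mulr0// bnd_simp -ltNge.
Qed.

Let thinned_meanB x y : 0 <= x -> x <= y ->
  L y - L x = lam * \int[mu]_(v in `[x, y]) b v.
Proof.
move=> x0 xy; rewrite /thinned_mean (@Rintegral_itv_cat _ b 0 x y)//; first by ring.
exact: (@bounded_integrable_itv _ _ _ _ 1).
Qed.

Lemma thinned_mean_le x y : x <= y -> L x <= L y.
Proof.
move=> xy; have [x0|/ltW x0] := leP 0 x; last by rewrite (thinned_mean_neg x0) thinned_mean_ge0.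
rewrite -subr_ge0 thinned_meanB// mulr_ge0 ?(ltW lam0)//.
by apply: Rintegral_ge0 => v _.
Qed.

Lemma measurable_thinned_mean : measurable_fun setT L.
Proof. by apply: nondecreasing_measurable => // x y; exact: thinned_mean_le. Qed.

Lemma indef_integral_thinned_mean u : indef_integral 0 u L (fun v => lam * b v).
Proof.
split.
- exact: measurable_thinned_mean.
- exact: measurable_funM.
- exists lam; first exact: ltW.
  by move=> x _; rewrite normrM gtr0_norm// ler_piMr// ltW.
- move=> x y x0 xy _; rewrite RintegralZl// ?thinned_meanB//.
  exact: (@bounded_integrable_itv _ _ _ _ 1).
Qed.

Lemma indef_integral_affine (p q s t : R) :
  indef_integral s t (fun v => p + q * v) (fun=> q).
Proof.
split => //.
- by apply: measurable_funD => //; exact: measurable_funM.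
- by exists `|q|.
- move=> x y _ xy _; rewrite Rintegral_cst//= lebesgue_measure_itv/= lte_fin.
  move: xy; rewrite le_eqVlt => /predU1P[->|->]/=; last by ring.
  by rewrite ltxx /= mulr0 subrr.
Qed.

(** The weight of [n] when the first arrival leaves time [v]: with probability [b v] it is accepted
    and [n - 1] further points are needed, otherwise still [n]. *)
Definition first_arrival_mix n v : R :=
  b v * pois_pred n (L v) + (1 - b v) * pois n (L v).

Lemma first_arrival_mix_ge0 n v : 0 <= first_arrival_mix n v.
Proof.
by rewrite addr_ge0// mulr_ge0 ?subr_ge0// ?pois_pred_ge0 ?pois_ge0// thinned_mean_ge0.
Qed.

Lemma measurable_first_arrival_mix n : measurable_fun setT (first_arrival_mix n).
Proof.
apply: measurable_funD; apply: measurable_funM => //.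
- by apply: measurableT_comp measurable_thinned_mean; exact: measurable_pois_pred.
- exact: measurable_funB.
- by apply: measurableT_comp measurable_thinned_mean; exact: measurable_pois.
Qed.

Let mexp u : measurable_fun setT (fun v : R => lam * expR (- (lam * (u - v)))).
Proof.
apply: measurable_funM => //.
apply: measurableT_comp; first exact: measurable_expR.
by apply: measurable_funN; apply: measurable_funM => //; exact: measurable_funB.
Qed.

(* Differentiating [expR (- lam * (u - v)) * pois n (L v)] in [v] yields the
   integrand on [0, u]. *)
Lemma renewal_pois n u :
  (\int[mu]_(v in `]-oo, u])
     ((first_arrival_mix n v)%:E * (lam * expR (- (lam * (u - v))))%:E) =
   (pois n (L u))%:E)%E.
Proof.
have mixneg v : v < 0 -> first_arrival_mix n v = (n == 0%N)%:R.
  move=> v0; rewrite /first_arrival_mix (thinned_mean_neg (ltW v0)) pois0 bneg//.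
  by rewrite mul0r subr0 mul1r add0r.
(* For negative [v] the first arrival comes after the horizon, and only [n = 0] contributes. *)
have tail c : c <= 0 -> (\int[mu]_(v in `]-oo, c[)
     ((first_arrival_mix n v)%:E * (lam * expR (- (lam * (u - v))))%:E) =
   ((n == 0%N)%:R * expR (- (lam * (u - c))))%:E)%E.
  move=> c0; transitivity (\int[mu]_(v in `]-oo, c[) ((n == 0%N)%:R%:E *
      (lam * expR (- (lam * (u - v)%R)))%:E))%E.
    by apply: eq_integral => v; rewrite inE/= in_itv/= => vc; rewrite mixneg// (lt_le_trans vc).
  rewrite ge0_integralZl//=; last 2 first.
  - by apply/measurable_EFinP; apply: measurable_funTS; exact: mexp.
  - by move=> v _; rewrite lee_fin mulr_ge0 ?expR_ge0 ?ltW.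
  rewrite integral_itv_bndo_bndc; last first.
    by apply/measurable_EFinP; apply: measurable_funTS; exact: mexp.
  by rewrite integral_exp_tail.
have mI : measurable_fun setT (fun v => (first_arrival_mix n v)%:E *
    (lam * expR (- (lam * (u - v))))%:E)%E.
  apply: emeasurable_funM; apply/measurable_EFinP; last exact: mexp.
  exact: measurable_first_arrival_mix.
have [u0|u0] := ltP u 0.
  rewrite -integral_itv_bndo_bndc; last exact: measurable_funTS.
  rewrite tail ?ltW// (thinned_mean_neg (ltW u0)) pois0.
  by rewrite subrr mulr0 oppr0 expR0 mulr1.
have -> : `]-oo, u]%classic = `]-oo, 0[ `|` `[0, u] :> set R.
  apply/seteqP; split => v; rewrite /= !in_itv/=.
    by move=> vu; have [v0|v0] := ltP v 0; [left|right].
  by case=> [v0|/andP[]//]; apply: le_trans (ltW v0) u0.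
rewrite ge0_integral_setU//=; last 3 first.
- exact: measurable_funTS.
- move=> v _; rewrite -EFinM lee_fin mulr_ge0 ?first_arrival_mix_ge0//.
  by rewrite mulr_ge0 ?expR_ge0 ?ltW.
- apply/disj_setPS => v; rewrite /= !in_itv/= => -[v0 /andP[]].
  by rewrite leNgt v0.
rewrite tail// subr0.
(* The exponential factor is written as [pois 0] of an affine function, so the chain rule for
   Poisson weights also serves for it. *)
have iE : indef_integral 0 u (fun v => lam * u + - lam * v) (fun=> - lam).
  exact: indef_integral_affine.
have iE0 : indef_integral 0 u (pois 0 \o (fun v => lam * u + - lam * v))
    (fun v => dpois 0 (lam * u + - lam * v) * - lam).
  apply: indef_integral_pois => // v /andP[v0 vu].
  by rewrite mulNr subr_ge0 ler_wpM2l// ltW.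
have iL := indef_integral_pois n (indef_integral_thinned_mean u)
  (fun x _ => thinned_mean_ge0 x).
have [mW mw [C C0 bw] WE] := indef_integral_mul iE0 iL.
set w := (fun v => _ + _) in mw bw WE.
have -> : (\int[mu]_(x in `[0%R, u])
    ((first_arrival_mix n x)%:E * (lam * expR (- (lam * (u - x))))%:E) =
    \int[mu]_(x in `[0%R, u]) (w x)%:E)%E.
  apply: eq_integral => v _; rewrite -EFinM; congr EFin.
  rewrite /w /= /dpois [pois_pred 0 _]/= pois_exp /first_arrival_mix.
  have -> : - (lam * u + - lam * v) = - (lam * (u - v)) by ring.
  ring.
have wi : mu.-integrable `[0, u] (EFin \o w).
  by apply: (@bounded_integrable_itv _ _ _ _ C).
have := WE 0 u (lexx _) u0 (lexx _); rewrite /Rintegral => h.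
rewrite -[X in (_ + X)%E]fineK; last exact: integrable_fin_num.
rewrite -h -EFinD; congr EFin => /=.
rewrite !pois_exp (thinned_mean_neg (lexx 0)) pois0.
have -> : - (lam * u + - lam * u) = 0 by ring.
have -> : - (lam * u + - lam * 0) = - (lam * u) by ring.
by rewrite expR0; ring.
Qed.

(** The weight [expR (lam * v)] turns the reflected density of rate [lam] into half of one of rate
    [2 * lam]; this is the source of the contraction ratio. *)
Lemma integral_exp_weight u :
  (\int[mu]_(v in `]-oo, u]) ((expR (lam * v))%:E * (lam * expR (- (lam * (u - v))))%:E) =
   (expR (lam * u) / 2)%:E)%E.
Proof.
have l2 : 0 < 2 * lam by rewrite mulr_gt0.
transitivity (\int[mu]_(v in `]-oo, u]) ((expR (lam * u) / 2)%:E *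
    (2 * lam * expR (- (2 * lam * (u - v)%R)))%:E))%E.
  apply: eq_integral => v _; rewrite -!EFinM; congr EFin.
  rewrite [RHS](_ : _ = lam * (expR (lam * u) * expR (- (2 * lam * (u - v))))); last by field.
  by rewrite mulrCA -!expRD; congr (_ * expR _); ring.
rewrite ge0_integralZl//=; last 2 first.
- apply/measurable_EFinP; apply: measurable_funTS; apply: measurable_funM => //.
  apply: measurableT_comp; first exact: measurable_expR.
  by apply: measurable_funN; apply: measurable_funM => //; exact: measurable_funB.
- by move=> v _; rewrite lee_fin mulr_ge0 ?expR_ge0 ?ltW.
by rewrite integral_exp_tail// subrr mulr0 oppr0 expR0 mule1.
Qed.

End renewal_equation.

(** * Thinning of a marked Poisson process *)

Definition pack2 {Omega R : Type} (U V : nat -> Omega -> R) (i : nat + nat) :=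
  match i with inl k => U k | inr k => V k end.

Section thinning.
Context (R : realType) (d : measure_display) (Omega : measurableType d).
Context (P : probability Omega R) (U V : nat -> Omega -> R).
Variables (lam : R) (D : set (R * R)) (b : R -> R).
Hypothesis lam0 : 0 < lam.
Hypothesis mU : forall k, measurable_fun setT (U k).
Hypothesis mV : forall k, measurable_fun setT (V k).
Hypothesis cdfU : forall k (x : R), P [set w | U k w <= x] =
  (if 0 <= x then 1 - expR (- (lam * x)) else 0)%:E.
Hypothesis indepUV : mutually_independent P (pack2 U V).
Hypothesis mD : measurable D.
Hypothesis mb : measurable_fun setT b.
Hypothesis bE : forall k v, P [set w | D (v, V k w)] = (b v)%:E.
Hypothesis bneg : forall v, v < 0 -> b v = 0.

Local Notation L := (thinned_mean lam b).

Let mZ i : measurable_fun setT (pack2 U V i).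
Proof. by case: i. Qed.

Let b01 v : 0 <= b v <= 1.
Proof.
rewrite -!lee_fin -(bE 0) measure_ge0/=; apply: probability_le1.
have -> : [set w | D (v, V 0 w)] = V 0 @^-1` xsection D v.
  by apply/seteqP; split => w /=; rewrite /xsection/= inE.
by rewrite -[X in measurable X]setTI; apply: mV => //; exact: measurable_xsection.
Qed.

(* Points [U_i], [U_i + U_(i+1)], ... seen as remaining times from horizon [u]. *)
Fixpoint accepted (m i : nat) (u : R) (w : Omega) : nat :=
  if m is m'.+1 then
    ((((u - U i w)%R, V i w) \in D) + accepted m' i.+1 (u - U i w)%R w)%N
  else 0%N.

Lemma measurable_nat_mem d' (T : measurableType d') (h : T -> R * R) :
  measurable_fun setT h -> measurable_fun setT (fun x => nat_of_bool (h x \in D)).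
Proof.
move=> mh; apply: (@measurable_fun_ifT _ _ _ _ (fun=> 1%N) (fun=> 0%N)) => //.
apply: (measurable_fun_bool true).
rewrite (_ : _ @^-1` _ = h @^-1` D); last first.
  by apply/seteqP; split => x /=; [exact: set_mem|exact: mem_set].
by rewrite -[X in measurable X]setTI setIA setTI; exact: mh.
Qed.

(** Horizon and sample point are separate functions of [x], and only indices from [i] on are asked
    to be measurable: on the product of two subspaces the horizon comes from one factor and the
    later variables from the other. *)
Lemma measurable_accepted d' (T : measurableType d') (f : T -> R) (g : T -> Omega) m i :
  measurable_fun setT f ->
  (forall k, (i <= k)%N -> measurable_fun setT (U k \o g)) ->
  (forall k, (i <= k)%N -> measurable_fun setT (V k \o g)) ->
  measurable_fun setT (fun x => accepted m i (f x) (g x)).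
Proof.
elim: m i f => [|m IH] i f mf mUg mVg /=; first exact: measurable_cst.
have mfU : measurable_fun setT (fun x => f x - U i (g x)).
  by apply: measurable_funB => //; exact: mUg.
apply: measurable_fun_addn.
  by apply: measurable_nat_mem; apply/measurable_fun_pair => //; exact: mVg.
by apply: IH => // k /ltnW; [exact: mUg|exact: mVg].
Qed.

Lemma measurable_accepted_id m i u : measurable_fun setT (accepted m i u).
Proof.
apply: (@measurable_accepted _ _ (fun=> u) id) => // k _.
- exact: mU.
- exact: mV.
Qed.

(** The starting index [i] is kept: the estimates are proved for all [i] at once, which replaces an
    argument that shifting the sequences preserves their joint law. *)
Definition accepted_prob m i n u : \bar R := P [set w | accepted m i u w = n].

Definition accepted_prob_pred m i n u : \bar R :=
  if n is n'.+1 then accepted_prob m i n' u else 0%E.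

Lemma measurable_accepted_prob m i n : measurable_fun setT (accepted_prob m i n).
Proof.
pose A := [set x : R * Omega | accepted m i x.1 x.2 = n].
have mA : measurable A.
  rewrite (_ : A = (fun x => accepted m i x.1 x.2) @^-1` [set n])//.
  rewrite -[X in measurable X]setTI.
  apply: (@measurable_accepted _ _ (fst : R * Omega -> R) snd) => //.
  - by move=> k _; exact: measurableT_comp.
  - by move=> k _; exact: measurableT_comp.
have -> : accepted_prob m i n = P \o xsection A.
  apply/funext => u /=; congr (P _).
  by apply/seteqP; split => w /=; rewrite /xsection/= inE.
exact: measurable_fun_xsection.
Qed.

Lemma measurable_accepted_prob_pred m i n :
  measurable_fun setT (accepted_prob_pred m i n).
Proof. by case: n => [|n]; [exact: measurable_cst|exact: (measurable_accepted_prob m i n)]. Qed.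

Lemma accepted_prob_ge0 m i n u : (0 <= accepted_prob m i n u)%E.
Proof. exact: measure_ge0. Qed.

Lemma accepted_prob_pred_ge0 m i n u : (0 <= accepted_prob_pred m i n u)%E.
Proof. by case: n => [|n] //=; exact: accepted_prob_ge0. Qed.

Let measurable_event (f : Omega -> nat) n : measurable_fun setT f ->
  measurable [set w | f w = n].
Proof.
move=> mf; rewrite (_ : [set _ | _] = f @^-1` [set n])//.
by rewrite -[X in measurable X]setTI; exact: mf.
Qed.

Let mem_event (T : Type) (f : T -> nat) n x : (x \in [set y | f y = n]) = (f x == n).
Proof. by apply/idP/eqP => [/set_mem|h]; [|exact: mem_set]. Qed.

(** The pair [(U i, V i)] is independent of all later variables, so the count after the first point
    may be integrated separately, with the remaining time as a frozen horizon. *)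
Lemma accepted_probS m i n u :
  (accepted_prob m.+1 i n u = \int[P]_w
    (if ((u - U i w)%R, V i w) \in D then accepted_prob_pred m i.+1 n (u - U i w)%R
     else accepted_prob m i.+1 n (u - U i w)%R))%E.
Proof.
pose J := [pred k : nat + nat | match k with inl k => k == i | inr k => k == i end].
pose J' := [pred k : nat + nat | match k with inl k => (i < k)%N | inr k => (i < k)%N end].
have JJ' k : J k -> ~~ J' k by case: k => k /= /eqP ->; rewrite ltnn.
pose W := sub_space (pack2 U V) J; pose W' := sub_space (pack2 U V) J'.
pose c (x : W * W') : nat := ((((u - U i x.1)%R, V i x.1) \in D) +
   accepted m i.+1 (u - U i x.1)%R x.2)%N.
have mUW : measurable_fun setT (fun x : W * W' => (u - U i x.1)%R).
  apply: measurable_funB => //.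
  apply: (@measurableT_comp _ _ _ _ _ _ (U i : W -> R) _ fst) => //.
  by apply: (@measurable_sub_space _ _ _ _ (pack2 U V) J (inl i)); rewrite /= eqxx.
have mVW : measurable_fun setT (fun x : W * W' => V i x.1).
  apply: (@measurableT_comp _ _ _ _ _ _ (V i : W -> R) _ fst) => //.
  by apply: (@measurable_sub_space _ _ _ _ (pack2 U V) J (inr i)); rewrite /= eqxx.
have mc : measurable_fun setT c.
  apply: measurable_fun_addn.
    by apply: measurable_nat_mem; exact/measurable_fun_pair.
  apply: (@measurable_accepted _ _ _ (snd : W * W' -> Omega)) => // k ik.
  - apply: (@measurableT_comp _ _ _ _ _ _ (U k : W' -> R) _ snd) => //.
    exact: (@measurable_sub_space _ _ _ _ (pack2 U V) J' (inl k)).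
  - apply: (@measurableT_comp _ _ _ _ _ _ (V k : W' -> R) _ snd) => //.
    exact: (@measurable_sub_space _ _ _ _ (pack2 U V) J' (inr k)).
have mA : measurable [set x | c x = n].
  rewrite (_ : [set _ | _] = c @^-1` [set n])//.
  by rewrite -[X in measurable X]setTI; exact: mc.
transitivity (\int[P]_w (\1_[set x | c x = n] (w, w))%:E)%E.
  transitivity (\int[P]_w (\1_[set w | accepted m.+1 i u w = n] w)%:E)%E.
    rewrite integral_indic ?setIT//.
    by apply: measurable_event; exact: (@measurable_accepted_id m.+1 i u).
  by apply: eq_integral => w _; rewrite !indicE.
rewrite (@indep_fubini _ _ _ _ _ _ mZ indepUV J J'
   (fun x => (\1_[set x | c x = n] x)%:E)) //; last first.
  by apply/measurable_EFinP; exact: measurable_indic.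
apply: eq_integral => w _.
have mAw : measurable [set w' | accepted m i.+1 (u - U i w) w' = n].
  exact/measurable_event/measurable_accepted_id.
case: ifPn => [Dw|/negbTE Dw]; last first.
  transitivity (\int[P]_w' (\1_[set w' | accepted m i.+1 (u - U i w)%R w' = n] w')%:E)%E.
    by apply: eq_integral => w' _; rewrite !indicE !mem_event /c/= Dw.
  by rewrite integral_indic// setIT.
case: n {mA mAw} => [|n] /=.
  by apply: integral0_eq => w' _; rewrite indicE mem_event /c/= Dw.
transitivity (\int[P]_w' (\1_[set w' | accepted m i.+1 (u - U i w)%R w' = n] w')%:E)%E.
  by apply: eq_integral => w' _; rewrite !indicE !mem_event /c/= Dw add1n eqSS.
by rewrite integral_indic ?setIT//; exact/measurable_event/measurable_accepted_id.
Qed.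

Let measurable_mark_event k v : measurable [set w | D (v, V k w)].
Proof.
have -> : [set w | D (v, V k w)] = V k @^-1` xsection D v.
  by apply/seteqP; split => w /=; rewrite /xsection/= inE.
by rewrite -[X in measurable X]setTI; apply: mV => //; exact: measurable_xsection.
Qed.

Let integral_mark k v (a c : R) : 0 <= a -> 0 <= c ->
  (\int[P]_w (if (v, V k w) \in D then a else c)%:E = (b v * a + (1 - b v) * c)%:E)%E.
Proof.
move=> a0 c0; set A := [set w | D (v, V k w)].
have mA : measurable A by exact: measurable_mark_event.
transitivity (\int[P]_w (a%:E * (\1_A w)%:E + c%:E * (\1_(~` A) w)%:E))%E.
  apply: eq_integral => w _; rewrite !indicE in_setC.
  have -> : (w \in A) = ((v, V k w) \in D) by rewrite /A; apply/idP/idP; rewrite !inE.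
  by case: ifPn => /= _; rewrite ?mule1 ?mule0 ?adde0 ?add0e.
have mi B : measurable B -> measurable_fun setT (EFin \o (\1_B : Omega -> R)).
  by move=> mB; apply/measurable_EFinP; exact: measurable_indic.
rewrite ge0_integralD//=; last 4 first.
- by move=> w _; rewrite mule_ge0// lee_fin.
- by apply: emeasurable_funM => //; exact: mi.
- by move=> w _; rewrite mule_ge0// lee_fin.
- by apply: emeasurable_funM => //; apply: mi; exact: measurableC.
rewrite !ge0_integralZl//=; last 2 first.
- by apply: mi; exact: measurableC.
- exact: mi.
rewrite !integral_indic//; last exact: measurableC.
have PC : P (~` A) = (1 - b v)%:E by rewrite probability_setC// bE.
transitivity (a%:E * P A + c%:E * P (~` A))%E; first by rewrite !setIT.
by rewrite PC bE -!EFinM -EFinD; congr EFin; ring.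
Qed.

(** Integrating the mark [V i] first yields [first_arrival_mix], and integrating [U i] next yields
    the renewal integral: the Poisson weights are a fixed point of the recursion of
    [accepted_probS]. *)
Lemma integral_first_arrival i n u :
  (\int[P]_w (if ((u - U i w)%R, V i w) \in D then pois_pred n (L (u - U i w)%R)
      else pois n (L (u - U i w)%R))%:E = (pois n (L u))%:E)%E.
Proof.
pose J := [pred k : nat + nat | k == inl i].
pose J' := [pred k : nat + nat | k == inr i].
have JJ' k : J k -> ~~ J' k by move=> /eqP ->.
pose W := sub_space (pack2 U V) J; pose W' := sub_space (pack2 U V) J'.
pose F (x : W * W') : R := if ((u - U i x.1)%R, V i x.2) \in D
  then pois_pred n (L (u - U i x.1)%R) else pois n (L (u - U i x.1)%R).
have mUW : measurable_fun setT (fun x : W * W' => (u - U i x.1)%R).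
  apply: measurable_funB => //.
  apply: (@measurableT_comp _ _ _ _ _ _ (U i : W -> R) _ fst) => //.
  by apply: (@measurable_sub_space _ _ _ _ (pack2 U V) J (inl i)); rewrite /= eqxx.
have mVW : measurable_fun setT (fun x : W * W' => V i x.2).
  apply: (@measurableT_comp _ _ _ _ _ _ (V i : W' -> R) _ snd) => //.
  by apply: (@measurable_sub_space _ _ _ _ (pack2 U V) J' (inr i)); rewrite /= eqxx.
have mL := measurable_thinned_mean lam0 mb b01.
have mF : measurable_fun setT F.
  apply: measurable_fun_ifT.
  - apply: (measurable_fun_bool true).
    rewrite (_ : _ @^-1` _ = (fun x : W * W' => ((u - U i x.1)%R, V i x.2)) @^-1` D); last first.
      by apply/seteqP; split => x /=; [exact: set_mem|exact: mem_set].
    by apply: (measurable_fun_pair mUW mVW).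
  - by apply: measurableT_comp; [exact: measurable_pois_pred|exact: measurableT_comp].
  - by apply: measurableT_comp; [exact: measurable_pois|exact: measurableT_comp].
have L0 v : 0 <= L v by exact: thinned_mean_ge0.
rewrite (@indep_fubini _ _ _ _ _ _ mZ indepUV J J' (EFin \o F)) //; last 2 first.
- exact/measurable_EFinP.
- by move=> x; rewrite lee_fin /F; case: ifP => _; [exact: pois_pred_ge0|exact: pois_ge0].
transitivity (\int[P]_w (first_arrival_mix lam b n (u - U i w)%R)%:E)%E.
  apply: eq_integral => w _; rewrite /= /F /= integral_mark//.
    exact: pois_pred_ge0.
  exact: pois_ge0.
rewrite (exponential_law_reflect lam0 (mU i) (cdfU i) u
   (g := fun v => (first_arrival_mix lam b n v)%:E)).
- exact: renewal_pois.
- by apply/measurable_EFinP; exact: measurable_first_arrival_mix.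
- by move=> v; rewrite lee_fin; exact: first_arrival_mix_ge0.
Qed.

Lemma integral_weight i u :
  (\int[P]_w (expR (lam * (u - U i w)))%:E = (expR (lam * u) / 2)%:E)%E.
Proof.
rewrite (exponential_law_reflect lam0 (mU i) (cdfU i) u
   (g := fun v => (expR (lam * v))%:E)).
- exact: integral_exp_weight.
- apply/measurable_EFinP; apply: measurableT_comp; first exact: measurable_expR.
  exact: measurable_funM.
- by move=> v; rewrite lee_fin expR_ge0.
Qed.

Let err m u : R := 2 ^- m * expR (lam * u).

Let err_ge0 m u : 0 <= err m u.
Proof. by rewrite mulr_ge0 ?expR_ge0// invr_ge0 exprn_ge0. Qed.

(* The exponential weight makes the first-arrival recursion a contraction of
   ratio 1/2, uniformly in [u]. *)
Lemma accepted_prob_near m i n u :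
  (accepted_prob m i n u <= (pois n (L u) + err m u)%:E)%E /\
  ((pois n (L u))%:E <= accepted_prob m i n u + (err m u)%:E)%E.
Proof.
have L0 v : 0 <= L v by exact: thinned_mean_ge0.
have mL := measurable_thinned_mean lam0 mb b01.
elim: m i n u => [|m IH] i n u.
  have -> : accepted_prob 0 i n u = (n == 0%N)%:R%:E.
    rewrite /accepted_prob /=; case: n => [|n] /=.
      by rewrite (_ : [set _ | _] = setT) ?probability_setT//; apply/seteqP; split.
    by rewrite (_ : [set _ | _] = set0) ?measure0//; apply/seteqP; split.
  rewrite -EFinD !lee_fin /err expr0 invr1 mul1r.
  (* With no arrival counted the law is the point mass at 0. For [0 <= u] the error is at least 1,
     which bounds the distance between numbers of [[0, 1]]; for [u < 0] the mean is 0 and both sides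
     coincide. *)
  have [u0|u0] := leP 0 u.
    have : 1 <= expR (lam * u) by rewrite -expR0 ler_expR mulr_ge0// ltW.
    have := pois_ge0 n (L0 u); have := pois_le1 n (L0 u).
    by case: (n == 0%N) => /=; lra.
  rewrite (thinned_mean_neg _ _ (ltW u0)) pois0.
  by rewrite lerDl expR_ge0.
have mUu : measurable_fun setT (fun w => u - U i w) by exact: measurable_funB.
have mDw : measurable_fun setT (fun w => ((u - U i w)%R, V i w) \in D).
  apply: (measurable_fun_bool true).
  rewrite (_ : _ @^-1` _ = (fun w => ((u - U i w)%R, V i w)) @^-1` D); last first.
    by apply/seteqP; split => x /=; [exact: set_mem|exact: mem_set].
  exact: (measurable_fun_pair mUu (mV i)).
pose p w : \bar R := if ((u - U i w)%R, V i w) \in D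
  then accepted_prob_pred m i.+1 n (u - U i w)%R
  else accepted_prob m i.+1 n (u - U i w)%R.
pose q w : R := if ((u - U i w)%R, V i w) \in D
  then pois_pred n (L (u - U i w)%R) else pois n (L (u - U i w)%R).
have mp : measurable_fun setT p.
  apply: measurable_fun_ifT => //; apply: measurableT_comp => //.
  - exact: measurable_accepted_prob_pred.
  - exact: measurable_accepted_prob.
have p0 w : (0 <= p w)%E.
  by rewrite /p; case: ifP => _; [exact: accepted_prob_pred_ge0|exact: accepted_prob_ge0].
have mq : measurable_fun setT (EFin \o q).
  apply/measurable_EFinP; apply: measurable_fun_ifT => //.
  - by apply: measurableT_comp; [exact: measurable_pois_pred|exact: measurableT_comp].
  - by apply: measurableT_comp; [exact: measurable_pois|exact: measurableT_comp].
have q0 w : (0 <= (q w)%:E)%E.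
  by rewrite lee_fin /q; case: ifP => _; [exact: pois_pred_ge0|exact: pois_ge0].
have me : measurable_fun setT (fun w => (err m (u - U i w)%R)%:E).
  apply/measurable_EFinP; apply: measurable_funM => //.
  apply: measurableT_comp; first exact: measurable_expR.
  exact: measurable_funM.
have e0 w : (0 <= (err m (u - U i w)%R)%:E)%E by rewrite lee_fin.
have ie : (\int[P]_w (err m (u - U i w)%R)%:E = (err m.+1 u)%:E)%E.
  rewrite /err; under eq_integral do rewrite EFinM.
  rewrite ge0_integralZl//=; last first.
  - apply/measurable_EFinP; apply: measurableT_comp; first exact: measurable_expR.
    exact: measurable_funM.
  rewrite integral_weight -EFinM; congr EFin; rewrite exprS.
  by field; rewrite expf_neq0.
have iq : (\int[P]_w (q w)%:E = (pois n (L u))%:E)%E by exact: integral_first_arrival.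
have pS : accepted_prob m.+1 i n u = (\int[P]_w p w)%E by exact: accepted_probS.
rewrite pS EFinD -iq -ie; split.
  rewrite -ge0_integralD//; apply: ge0_le_integral => //.
    exact: emeasurable_funD.
  move=> w _; rewrite -EFinD /p /q; case: ifP => _; last by have [] := IH i.+1 n (u - U i w).
  case: n {p q mp p0 mq q0 pS iq} => [|n] /=; last by have [] := IH i.+1 n (u - U i w).
  by rewrite add0r lee_fin.
rewrite -ge0_integralD//; apply: ge0_le_integral => //.
  exact: emeasurable_funD.
move=> w _; rewrite /p /q; case: ifP => _; last by have [] := IH i.+1 n (u - U i w).
case: n {p q mp p0 mq q0 pS iq} => [|n] /=; last by have [] := IH i.+1 n (u - U i w).
by rewrite add0e lee_fin.
Qed.

Lemma accepted_sum m i u w : accepted m i u w =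
  (\sum_(k < m) (((u - \sum_(j < k.+1) U (i + j)%N w)%R, V (i + k)%N w) \in D))%N.
Proof.
elim: m i u => [|m IH] i u /=; first by rewrite big_ord0.
rewrite big_ord_recl IH /= big_ord1 !addn0; congr (_ + _)%N.
apply: eq_bigr => k _; rewrite addSnnS; congr nat_of_bool; congr (_ \in D); congr pair.
rewrite [in RHS]big_ord_recl/= addn0 opprD addrA; congr (_ - _).
by apply: eq_bigr => j _; rewrite addSnnS.
Qed.

(** Listing the accepted indices, as [N_eq] does, leaves infinitely many acceptances possible; such
    a sample point belongs to the event for no [n]. *)
Definition exactly_accepted n u : set Omega := [set w | exists s : seq nat,
  [/\ uniq s, size s = n & forall k, D (u - epoch U k w, V k w) <-> k \in s]].

(** The truncated count is nondecreasing in [m]. If it took the value [n] for arbitrarily large [m]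
    it would stay at [n] from some point on, and the indices accepted by then would be all of them.
    This holds at every sample point, with no null set. *)
Lemma accepted_eventually n u w : exists M, forall m, (M <= m)%N ->
  accepted m 0 u w = n <-> exactly_accepted n u w.
Proof.
pose c (k : nat) := (u - epoch U k w, V k w) \in D.
have cE m : accepted m 0 u w = count c (iota 0 m).
  elim: m => // m IH.
  rewrite -[in RHS](addn1 m) iotaD count_cat -IH !accepted_sum big_ord_recr.
  by rewrite /= addn0.
have cmono m m' : (m <= m')%N -> (count c (iota 0 m) <= count c (iota 0 m'))%N.
  by move=> mm'; rewrite -(subnKC mm') iotaD count_cat leq_addr.
have [[s [us ss sP]]|nN] := pselect (exactly_accepted n u w).
  (* Past the largest accepted index the truncated count has seen the whole list. *)
  exists (\max_(k <- s) k).+1 => m sm; split => [_|_]; first by exists s.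
  rewrite cE -size_filter -ss; apply: perm_size.
  apply: uniq_perm => // [|k]; first by rewrite filter_uniq// iota_uniq.
  rewrite mem_filter mem_iota/= add0n; apply/andP/idP => [[/set_mem/sP]//|ks].
  split; first by apply/mem_set/sP.
  by apply: leq_trans sm; rewrite ltnS; exact: leq_bigmax_seq.
apply: contrapT => /forallNP H.
have cn M : exists2 m, (M <= m)%N & count c (iota 0 m) = n.
  have /existsNP[m /not_implyP[Mm h]] := H M.
  exists m => //; rewrite -cE; apply: contrapT => hn; apply: h.
  by split => [/hn//|/nN].
have [m0 _ m0n] := cn 0%N.
have cst m : (m0 <= m)%N -> count c (iota 0 m) = n.
  move=> m0m; have [m' mm' m'n] := cn m.
  by apply/eqP; rewrite eqn_leq -{1}m'n cmono// -m0n cmono.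
apply: nN; exists [seq k <- iota 0 m0 | c k]; split.
- by rewrite filter_uniq// iota_uniq.
- by rewrite size_filter.
move=> k; rewrite mem_filter mem_iota/= add0n; split => [Dk|/andP[/set_mem]//].
rewrite (mem_set Dk : c k)/= ltnNge; apply/negP => m0k.
have := cst k.+1 (leqW m0k).
rewrite -addn1 iotaD count_cat (cst k m0k) /= (mem_set Dk : c k).
by move=> /eqP; rewrite -[X in _ == X]addn0 eqn_add2l.
Qed.

Let measurable_accepted_eq n u m : measurable [set w | accepted m 0 u w = n].
Proof. exact/measurable_event/measurable_accepted_id. Qed.

Lemma measurable_exactly_accepted n u : measurable (exactly_accepted n u).
Proof.
have -> : exactly_accepted n u =
    \bigcup_M \bigcap_(m in [set m | (M <= m)%N]) [set w | accepted m 0 u w = n].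
  apply/seteqP; split => [w Nw|w [M _ /= Mw]].
    have [M HM] := accepted_eventually n u w.
    by exists M => // m /= /HM ->.
  have [M' HM'] := accepted_eventually n u w.
  by apply/(HM' (maxn M M')); [exact: leq_maxr|apply: Mw; exact: leq_maxl].
by apply: bigcup_measurable => M _; apply: bigcap_measurableType.
Qed.

Lemma cvg_accepted_prob n u :
  accepted_prob m 0 n u @[m --> \oo] --> P (exactly_accepted n u).
Proof.
have mA m := measurable_accepted_eq n u m.
have mN := measurable_exactly_accepted n u.
have mi A : measurable A -> measurable_fun setT (EFin \o (\1_A : Omega -> R)).
  by move=> mA'; apply/measurable_EFinP; exact: measurable_indic.
have [||| _ _] := @dominated_convergence _ _ _ P setT measurableT
  (fun m w => (\1_[set w | accepted m 0 u w = n] w)%:E)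
  (fun w => (\1_(exactly_accepted n u) w)%:E) (cst 1%E)
  (fun m => mi _ (mA m)) (mi _ mN).
- apply: aeW => w _; have [M HM] := accepted_eventually n u w.
  apply: cvg_near_cst; exists M => // m /= /HM h; rewrite !indicE.
  by congr (_ %:R%:E); congr nat_of_bool; apply: asbool_equiv_eq.
- apply/integrableP; split => //; rewrite [ltLHS](_ : _ = 1%E) ?ltry//.
  under eq_integral do rewrite /= normr1.
  by rewrite integral_cst// mul1e; exact: probability_setT.
- by apply: aeW => w m _; rewrite /= indicE; case: (_ \in _); rewrite /= ?normr0 ?normr1 lee_fin.
rewrite integral_indic// setIT.
under eq_fun do rewrite integral_indic// setIT.
exact.
Qed.

(** One sequence has two limits: the probability of the event, by dominated convergence, and the
    Poisson weight, since the error vanishes as [m] grows with [u] fixed. *)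
Lemma thinning n u : P (exactly_accepted n u) = (pois n (L u))%:E.
Proof.
have err0 : err m u @[m --> \oo] --> 0.
  rewrite -(mul0r (expR (lam * u))); apply: cvgMl.
  under eq_fun do rewrite -exprVn.
  by apply: cvg_expr; rewrite ger0_norm ?invr_ge0// invf_lt1// ltr1n.
suff h : accepted_prob m 0 n u @[m --> \oo] --> (pois n (L u))%:E.
  by rewrite -(cvg_lim (@ereal_hausdorff R) h); apply/esym/cvg_lim => //;
    exact: cvg_accepted_prob.
apply: (@squeeze_cvge _ _ _ _ (fun m => (pois n (L u) - err m u)%:E) _
  (fun m => (pois n (L u) + err m u)%:E)).
- near=> m; have [h1 h2] := accepted_prob_near m 0 n u.
  by rewrite h1 andbT EFinB leeBlDr.
- apply: cvg_EFin; first by near=> m.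
  rewrite -[X in _ --> X]subr0; apply: cvgB => //; exact: cvg_cst.
- apply: cvg_EFin; first by near=> m.
  rewrite -[X in _ --> X]addr0; apply: cvgD => //; exact: cvg_cst.
Unshelve. all: by end_near. Qed.

End thinning.

(** * Partial sums of the complex exponential series, in real and imaginary parts *)

Section complex_exponential_series.
Context (R : realType).
Implicit Types (c : nat -> R) (m n : nat) (v : R).

Lemma derive_le_le (f g df dg : R -> R) v :
  (forall x : R, is_derive x 1 f (df x)) -> (forall x : R, is_derive x 1 g (dg x)) ->
  f 0 = 0 -> g 0 = 0 -> 0 <= v -> (forall x, 0 <= x <= v -> df x <= dg x) ->
  f v <= g v.
Proof.
move=> hf hg f0 g0 v0 le.
have hd (x : R) : is_derive x 1 (g - f) (dg x - df x) by exact: is_deriveB.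
have cont : {within `[0, v], continuous (g - f)}.
  by apply: derivable_within_continuous => z _; have [] := hd z.
have [x] := MVT_segment v0 (fun x _ => hd x) cont.
rewrite in_itv/= => xv; rewrite !fctE f0 g0 subrr !subr0 => e.
by rewrite -subr_ge0 e mulr_ge0// subr_ge0 le.
Qed.

Lemma derive_norm_le (f g df dg : R -> R) v :
  (forall x : R, is_derive x 1 f (df x)) -> (forall x : R, is_derive x 1 g (dg x)) ->
  f 0 = 0 -> g 0 = 0 -> 0 <= v -> (forall x, 0 <= x <= v -> `|df x| <= dg x) ->
  `|f v| <= g v.
Proof.
move=> hf hg f0 g0 v0 le; rewrite ler_norml; apply/andP; split; last first.
  by apply: (derive_le_le hf hg) => // x /le /(le_trans (ler_norm _)).
rewrite lerNl; apply: (@derive_le_le (- f) g (fun x => - df x) dg) => //.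
  by rewrite fctE f0 oppr0.
by move=> x /le; rewrite -normrN => /(le_trans (ler_norm _)).
Qed.

Definition exp_sum c m v : R := \sum_(n < m) c n * (v ^+ n / n`!%:R).

Lemma is_derive_exp_monomial n v :
  is_derive v 1 (fun x : R => x ^+ n.+1 / n.+1`!%:R) (v ^+ n / n`!%:R).
Proof.
have d2 : is_derive v 1 (fun x : R => x ^+ n.+1) (n.+1%:R * v ^+ n).
  have := @is_deriveX _ _ id n.+1 v 1 1 (is_derive_id v 1).
  rewrite /GRing.scale/= mulr1; congr (is_derive _ _ _ _).
  by apply/funext => x; rewrite fctE.
have -> : (fun x : R => x ^+ n.+1 / n.+1`!%:R) = n.+1`!%:R^-1 \*: (fun x : R => x ^+ n.+1).
  by apply/funext => x; exact: mulrC.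
apply: is_derive_eq; rewrite /GRing.scale/= factS natrM; field.
by rewrite addrC natr1 !pnatr_eq0 -lt0n fact_gt0.
Qed.

(** Differentiation shifts the coefficients and drops one term; for powers of a complex number the
    shift is multiplication by it, which closes the induction on the remainder. *)
Lemma is_derive_exp_sum c m v :
  is_derive v 1 (exp_sum c m.+1) (exp_sum (fun n => c n.+1) m v).
Proof.
elim: m => [|m IH].
  rewrite /exp_sum big_ord0 (_ : (fun _ => _) = cst (c 0%N)).
    exact: is_derive_cst.
  by apply/funext => x; rewrite big_ord1 expr0 fact0 divr1 mulr1.
have -> : exp_sum c m.+2 = exp_sum c m.+1 +
    c m.+1 \*: (fun x : R => x ^+ m.+1 / m.+1`!%:R).
  by apply/funext => x; rewrite /exp_sum big_ord_recr !fctE /GRing.scale.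
have dm := is_derive_exp_monomial m v.
by apply: is_derive_eq; rewrite /exp_sum [in RHS]big_ord_recr.
Qed.

Variables (a b : R).
Hypothesis a1 : `|a| <= 1.
Hypothesis b1 : `|b| <= 1.
Variables (zr zi : nat -> R).
Hypothesis zr0 : zr 0%N = 1.
Hypothesis zi0 : zi 0%N = 0.
Hypothesis zrS : forall n, zr n.+1 = a * zr n - b * zi n.
Hypothesis ziS : forall n, zi n.+1 = a * zi n + b * zr n.

(** With [z = a + i b], the functions [C] and [S] are the real and imaginary parts of the
    exponential of [z v], and [zr], [zi] those of the powers of [z]; the estimates stay within real
    analysis. *)
Let C v : R := expR (a * v) * cos (b * v).
Let S v : R := expR (a * v) * sin (b * v).

Let dlin (k v : R) : is_derive v 1 (fun x => k * x) k.
Proof.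
have -> : (fun x => k * x) = k \*: (id : R -> R) by [].
by apply: is_derive_eq; rewrite /GRing.scale/= mulr1.
Qed.

Let dexp v : is_derive v 1 (fun x => expR (a * x)) (expR (a * v) * a).
Proof. exact: (is_derive1_comp (f := expR) (g := fun x => a * x)). Qed.
Let dcos v : is_derive v 1 (fun x => cos (b * x)) (- sin (b * v) * b).
Proof. exact: (is_derive1_comp (f := cos) (g := fun x => b * x)). Qed.
Let dsin v : is_derive v 1 (fun x => sin (b * x)) (cos (b * v) * b).
Proof. exact: (is_derive1_comp (f := sin) (g := fun x => b * x)). Qed.

Let dC v : is_derive v 1 C (a * C v - b * S v).
Proof.
have -> : C = (fun x => expR (a * x)) * (fun x => cos (b * x)) by [].
by apply: is_derive_eq; rewrite /GRing.scale/= fctE /S; ring.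
Qed.

Let dS v : is_derive v 1 S (a * S v + b * C v).
Proof.
have -> : S = (fun x => expR (a * x)) * (fun x => sin (b * x)) by [].
by apply: is_derive_eq; rewrite /GRing.scale/= fctE /C; ring.
Qed.

Let exp_sum_zr m v : exp_sum (fun n => zr n.+1) m v = a * exp_sum zr m v - b * exp_sum zi m v.
Proof.
rewrite /exp_sum !mulr_sumr -sumrB; apply: eq_bigr => n _; rewrite zrS; ring.
Qed.

Let exp_sum_zi m v : exp_sum (fun n => zi n.+1) m v = a * exp_sum zi m v + b * exp_sum zr m v.
Proof.
rewrite /exp_sum !mulr_sumr -big_split; apply: eq_bigr => n _ /=; rewrite ziS; ring.
Qed.

Let exp_sumS0 c m : exp_sum c m.+1 0 = c 0%N.
Proof.
rewrite /exp_sum big_ord_recl expr0 fact0 divr1 mulr1 big1 ?addr0// => i _.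
by rewrite expr0n /= mul0r mulr0.
Qed.

(* Each derivative of the remainder of order [m+1] is a combination, with
   coefficients bounded by 1, of the two remainders of order [m]. *)
Lemma exp_sum_remainder V m v : 0 <= v <= V ->
  `|C v - exp_sum zr m v| <= expR V * (2 ^+ m * (v ^+ m / m`!%:R)) /\
  `|S v - exp_sum zi m v| <= expR V * (2 ^+ m * (v ^+ m / m`!%:R)).
Proof.
elim: m v => [|m IH] v /andP[v0 vV].
  rewrite /exp_sum !big_ord0 !subr0 !expr0 fact0 divr1 !mulr1 /C /S !normrM.
  have e : `|expR (a * v)| <= expR V.
    rewrite ger0_norm ?expR_ge0// ler_expR (le_trans _ vV)//.
    by rewrite ler_piMl// (le_trans (ler_norm _)).
  split; rewrite -[leRHS]mulr1 ler_pM//.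
    by rewrite ler_norml cos_geN1 cos_le1.
  by rewrite ler_norml sin_geN1 sin_le1.
pose g (x : R) := expR V * (2 ^+ m.+1 * (x ^+ m.+1 / m.+1`!%:R)).
pose dg (x : R) := expR V * (2 ^+ m.+1 * (x ^+ m / m`!%:R)).
have hg (x : R) : is_derive x 1 g (dg x).
  have -> : g = (expR V * 2 ^+ m.+1) \*: (fun x : R => x ^+ m.+1 / m.+1`!%:R).
    by apply/funext => y; rewrite /g mulrA.
  have dm := is_derive_exp_monomial m x.
  by apply: is_derive_eq; rewrite /GRing.scale/= -mulrA.
have g0 : g 0 = 0 by rewrite /g expr0n/= mul0r !mulr0.
have comb (k l p q e : R) : `|k| <= 1 -> `|l| <= 1 -> `|p| <= e -> `|q| <= e ->
    `|k * p + l * q| <= 2 * e.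
  move=> k1 l1 pe qe; rewrite mulr2n mulrDl mul1r (le_trans (ler_normD _ _))//.
  by rewrite lerD// normrM -[leRHS]mul1r ler_pM.
have xV x : 0 <= x <= v -> 0 <= x <= V.
  by move=> /andP[x0 xv]; rewrite x0 (le_trans xv).
split.
- apply: (@derive_norm_le (C - exp_sum zr m.+1) g
    (fun x => (a * C x - b * S x) - exp_sum (fun n => zr n.+1) m x) dg) => //.
  + by move=> x; have ? := is_derive_exp_sum zr m x; exact: is_deriveB.
  + by rewrite !fctE exp_sumS0 zr0 /C !mulr0 expR0 cos0 mulr1 subrr.
  + move=> x /xV/IH[h1 h2]; rewrite exp_sum_zr.
    have -> : a * C x - b * S x - (a * exp_sum zr m x - b * exp_sum zi m x) =
      a * (C x - exp_sum zr m x) + - b * (S x - exp_sum zi m x) by ring.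
    apply: (le_trans (comb _ _ _ _ _ a1 _ h1 h2)); first by rewrite normrN.
    by rewrite /dg exprS le_eqVlt; apply/orP; left; apply/eqP; ring.
- apply: (@derive_norm_le (S - exp_sum zi m.+1) g
    (fun x => (a * S x + b * C x) - exp_sum (fun n => zi n.+1) m x) dg) => //.
  + by move=> x; have ? := is_derive_exp_sum zi m x; exact: is_deriveB.
  + by rewrite !fctE exp_sumS0 zi0 /S !mulr0 expR0 sin0 mulr0 subrr.
  + move=> x /xV/IH[h1 h2]; rewrite exp_sum_zi.
    have -> : a * S x + b * C x - (a * exp_sum zi m x + b * exp_sum zr m x) =
      a * (S x - exp_sum zi m x) + b * (C x - exp_sum zr m x) by ring.
    apply: (le_trans (comb _ _ _ _ _ a1 b1 h2 h1)).
    by rewrite /dg exprS le_eqVlt; apply/orP; left; apply/eqP; ring.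
Qed.

(** The remainder bound at the right end of [[0, V]]: up to the factor [expR V], the general term of
    the series of [expR (2 * V)], hence a null sequence. *)
Definition pois_error V m : R := expR V * ((2 * V) ^+ m / m`!%:R).

Lemma cvg_pois_error V : pois_error V m @[m --> \oo] --> 0.
Proof.
rewrite -(mulr0 (expR V)); apply: cvgMr.
have := @cvg_series_cvg_0 _ R (exp_coeff (2 * V)); apply.
exact: is_cvg_series_exp_coeff.
Qed.

Let sum_pois c m v : \sum_(n < m) c n * pois n v = expR (- v) * exp_sum c m v.
Proof.
by rewrite /exp_sum mulr_sumr; apply: eq_bigr => n _; rewrite /pois; ring.
Qed.

Lemma sum_pois_near V m v : 0 <= v <= V ->
  `|\sum_(n < m) zr n * pois n v - expR (- ((1 - a) * v)) * cos (b * v)|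
    <= pois_error V m /\
  `|\sum_(n < m) zi n * pois n v - expR (- ((1 - a) * v)) * sin (b * v)|
    <= pois_error V m.
Proof.
move=> vV; have [h1 h2] := exp_sum_remainder m vV.
have /andP[v0 vV'] := vV.
have e : expR (- ((1 - a) * v)) = expR (- v) * expR (a * v).
  by rewrite -expRD; congr expR; ring.
have e1 : expR (- v) <= 1 by rewrite -expR0 ler_expR oppr_le0.
have le : expR V * (2 ^+ m * (v ^+ m / m`!%:R)) <= pois_error V m.
  rewrite ler_wpM2l ?expR_ge0// mulrA -exprMn ler_wpM2r ?invr_ge0//.
  by rewrite lerXn2r ?nnegrE ?mulr_ge0 ?ler_wpM2l// (le_trans v0).
rewrite !sum_pois e -!mulrA -!mulrBr !normrM !(ger0_norm (expR_ge0 _)).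
split; rewrite distrC.
  by rewrite (le_trans _ le)// (le_trans _ h1)// ler_piMl.
by rewrite (le_trans _ le)// (le_trans _ h2)// ler_piMl.
Qed.

End complex_exponential_series.

(** * Independent subfamilies and measurability of counting events *)

(** The partial inverse [g] transports the events along the injection [f]; indices outside its image
    receive [setT]. It extracts two of the three packed families. *)
Lemma mutually_independent_reindex (R : realType) d (Omega : measurableType d)
    (P : probability Omega R) (I I' : eqType) (Z : I' -> Omega -> R)
    (Z' : I -> Omega -> R) (f : I -> I') (g : I' -> option I) :
  pcancel f g -> (forall i, Z' i = Z (f i)) ->
  mutually_independent P Z -> mutually_independent P Z'.
Proof.
move=> fK Z'E iZ s A us mA.
pose A' i' := if g i' is Some i then A i else setT.
have A'f i : A' (f i) = A i by rewrite /A' fK.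
have := iZ (map f s) A'; rewrite (map_inj_uniq (pcan_inj fK)) big_map => /(_ us).
have -> : \bigcap_(i in [set` map f s]) (Z i @^-1` A' i) =
    \bigcap_(i in [set` s]) (Z' i @^-1` A i).
  apply/seteqP; split => [w H i /= si|w H _ /= /mapP[i si ->]].
    by have := H (f i); rewrite /= map_f// A'f Z'E; exact.
  by have := H i si; rewrite /= A'f Z'E.
move=> ->; first by apply: eq_bigr => i _; rewrite A'f Z'E.
by move=> _ /mapP[i si ->]; rewrite A'f; exact: mA.
Qed.

Lemma eq_indic (R : pzRingType) (T T' : Type) (A : set T) (A' : set T') x x' :
  (A x <-> A' x') -> \1_A x = \1_A' x' :> R.
Proof.
move=> [h h']; rewrite !indicE; have -> // : (x \in A) = (x' \in A').
by apply/idP/idP => /set_mem; [move=> /h|move=> /h'] => ?; exact: mem_set.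
Qed.

Section measurability.
Context (R : realType) d (T : measurableType d).

(** There are only countably many finite lists of naturals, and each prescribes countably many
    memberships. *)
Lemma measurable_exact_set (Q : nat -> set T) n : (forall k, measurable (Q k)) ->
  measurable [set x | exists s : seq nat,
    [/\ uniq s, size s = n & forall k, Q k x <-> k \in s]].
Proof.
move=> mQ.
pose F (s : seq nat) := [set x : T | [/\ uniq s, size s = n & forall k, Q k x <-> k \in s]].
have -> : [set x | exists s : seq nat,
    [/\ uniq s, size s = n & forall k, Q k x <-> k \in s]] = \bigcup_s F s.
  by apply/seteqP; split => x [s]; [exists s|move=> _; exists s].
apply: countable_bigcupT_measurable => // s.
have [us|us] := boolP (uniq s); last first.
  rewrite (_ : F s = set0)//; apply/seteqP; split => // x [].
  by rewrite (negbTE us).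
have [ss|ss] := eqVneq (size s) n; last first.
  rewrite (_ : F s = set0)//; apply/seteqP; split => // x [_ /eqP].
  by rewrite (negbTE ss).
have -> : F s = \bigcap_k (if k \in s then Q k else ~` Q k).
  apply/seteqP; split => [x [_ _ H] k _|x H].
    by case: ifPn => [/H//|ks /H]; rewrite (negbTE ks).
  split => // k; have := H k Logic.I; case: ifPn => // ks Qk; split => //.
apply: bigcapT_measurable => k; case: ifP => _ //; exact: measurableC.
Qed.

Lemma measurable_le_set (f g : T -> R) : measurable_fun setT f ->
  measurable_fun setT g -> measurable [set x | f x <= g x].
Proof.
move=> mf mg.
rewrite (_ : [set x | _] = (fun x => f x <= g x) @^-1` [set true])//.
by rewrite -[X in measurable X]setTI; exact: (measurable_fun_ler mf mg).
Qed.

Lemma measurable_lt_set (f g : T -> R) : measurable_fun setT f ->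
  measurable_fun setT g -> measurable [set x | f x < g x].
Proof.
move=> mf mg.
rewrite (_ : [set x | _] = (fun x => f x < g x) @^-1` [set true])//.
by rewrite -[X in measurable X]setTI; exact: (measurable_fun_ltr mf mg).
Qed.

Lemma measurable_epoch (Omega : Type) (X : nat -> Omega -> R) (g : T -> Omega) k :
  (forall j, measurable_fun setT (X j \o g)) ->
  measurable_fun setT (fun x => epoch X k (g x)).
Proof. by move=> mX; apply: measurable_sum => j; exact: mX. Qed.

End measurability.

(* No catastrophe during the last [v] units of time before [t]. *)
Definition clear {Omega : Type} {R : realType} (nu : R) (Y : nat -> Omega -> R)
  (t : R) (w : Omega) (v : R) : Prop :=
  ~ (0 < nu /\ exists j, 0 <= t - epoch Y j w <= v).

Lemma measurable_clear (R : realType) d (T : measurableType d) (Omega : Type)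
    (nu t : R) (Y : nat -> Omega -> R) (g : T -> Omega) (f : T -> R) :
  (forall j, measurable_fun setT (Y j \o g)) -> measurable_fun setT f ->
  measurable [set x | clear nu Y t (g x) (f x)].
Proof.
move=> mY mf; have [nu0|nu0] := boolP (0 < nu); last first.
  rewrite (_ : [set _ | _] = setT)//; apply/seteqP; split => // x _ [].
  by rewrite (negbTE nu0).
have -> : [set x | clear nu Y t (g x) (f x)] = ~` (\bigcup_j
    ([set x | 0 <= t - epoch Y j (g x)] `&` [set x | t - epoch Y j (g x) <= f x])).
  apply/seteqP; split => [x H [j _ [/= h1 h2]]|x H [_ [j /andP[h1 h2]]]].
    by apply: H; split => //; exists j; rewrite h1.
  by apply: H; exists j.
apply: measurableC; apply: bigcupT_measurable => j.
have mE : measurable_fun setT (fun x => t - epoch Y j (g x)).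
  by apply: measurable_funB => //; exact: measurable_epoch.
by apply: measurableI; exact: measurable_le_set.
Qed.

(** * The law of the number present: catastrophes frozen, then averaged *)

Section catastrophes.
Context (R : realType) (d : measure_display) (Omega : measurableType d).
Context (P : probability Omega R) (lam nu : R) (B : R -> R).
Context (X Y S : nat -> Omega -> R).
Local Notation mu := (@lebesgue_measure R).
Hypothesis lam0 : 0 < lam.
Hypothesis nu0 : 0 <= nu.
Hypothesis mX : forall k, measurable_fun setT (X k).
Hypothesis mY : forall k, measurable_fun setT (Y k).
Hypothesis mS : forall k, measurable_fun setT (S k).
Hypothesis cdfX : forall k (x : R), P [set w | X k w <= x] =
     (if 0 <= x then 1 - expR (- (lam * x)) else 0)%:E.
Hypothesis cdfY : 0 < nu -> forall k (x : R), P [set w | Y k w <= x] =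
     (if 0 <= x then 1 - expR (- (nu * x)) else 0)%:E.
Hypothesis cdfS : forall k (x : R), P [set w | S k w <= x] = (B x)%:E.
Hypothesis indep : mutually_independent P (pack3 X Y S).
Variable t : R.
Hypothesis t0 : 0 <= t.

Local Notation clear := (clear nu Y t).

Let mle k x : measurable [set w | S k w <= x].
Proof. exact: measurable_le_set. Qed.

Let B01 x : 0 <= B x <= 1.
Proof.
by rewrite -!lee_fin -(cdfS 0) measure_ge0/=; exact: probability_le1.
Qed.

Let mB : measurable_fun setT B.
Proof.
apply: nondecreasing_measurable => // x y xy.
rewrite -lee_fin -!(cdfS 0); apply: le_measure; rewrite ?inE//.
by move=> w /= /le_trans; apply.
Qed.

(** The cut at 0 expresses that a customer arriving after the horizon is not present, as thinning
    requires of its acceptance probability. *)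
Definition survival (v : R) : R := if 0 <= v then 1 - B v else 0.

Lemma survival01 v : 0 <= survival v <= 1.
Proof.
rewrite /survival; case: ifP => _; last by rewrite lexx ler01.
by have /andP[? ?] := B01 v; rewrite subr_ge0 lerBlDr lerDl; apply/andP.
Qed.

Lemma survival_neg v : v < 0 -> survival v = 0.
Proof. by rewrite ltNge /survival => /negbTE ->. Qed.

Lemma measurable_survival : measurable_fun setT survival.
Proof.
apply: measurable_fun_ifT => //; last exact: measurable_funB.
exact: measurable_fun_ler.
Qed.

Lemma indep_catastrophe_service : mutually_independent P (pack2 Y S).
Proof.
apply: (@mutually_independent_reindex _ _ _ _ _ _ _ _
  (fun i : nat + nat => match i with inl k => inl (inr k) | inr k => inr k end)
  (fun i : (nat + nat) + nat => match i with
     inl (inr k) => Some (inl k) | inr k => Some (inr k) | _ => None end) _ _ indep).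
- by case.
- by case.
Qed.

Lemma indep_arrival_service : mutually_independent P (pack2 X S).
Proof.
apply: (@mutually_independent_reindex _ _ _ _ _ _ _ _
  (fun i : nat + nat => match i with inl k => inl (inl k) | inr k => inr k end)
  (fun i : (nat + nat) + nat => match i with
     inl (inl k) => Some (inl k) | inr k => Some (inr k) | _ => None end) _ _ indep).
- by case.
- by case.
Qed.

Lemma prob_clear v : 0 <= v <= t ->
  P [set w | clear w v] = (expR (- (nu * v)))%:E.
Proof.
move=> /andP[v0 vt]; have [nup|nun] := boolP (0 < nu); last first.
  have -> : [set w | clear w v] = setT.
    by apply/seteqP; split => // w _ []; rewrite (negbTE nun).
  have -> : nu = 0 by apply/eqP; rewrite eq_le nu0 andbT leNgt.
  by rewrite mul0r oppr0 expR0 probability_setT.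
(* Acceptance is decided by the remaining time alone, so the accepted points are the catastrophes of
   the last [v] units; the case [n = 0] of thinning is the claim. *)
pose D : set (R * R) := [set x | 0 <= x.1] `&` [set x | x.1 <= v].
pose b (x : R) : R := if 0 <= x <= v then 1 else 0.
have mD : measurable D by apply: measurableI; exact: measurable_le_set.
have mb : measurable_fun setT b.
  apply: measurable_fun_ifT => //.
  by apply: measurable_and; exact: measurable_fun_ler.
have bE k x : P [set w | D (x, S k w)] = (b x)%:E.
  rewrite /b; case: ifPn => [/andP[h1 h2]|h].
    rewrite (_ : [set _ | _] = setT) ?probability_setT//.
    by apply/seteqP; split.
  rewrite (_ : [set _ | _] = set0) ?measure0//.
  by apply/seteqP; split => // w [/= h1 h2]; move: h; rewrite h1 h2.
have bneg x : x < 0 -> b x = 0 by rewrite /b ltNge => /negbTE ->.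
have := thinning nup mY mS (cdfY nup) indep_catastrophe_service mD mb bE bneg 0 t.
have -> : thinned_mean nu b t = nu * v.
  rewrite /thinned_mean; congr (_ * _).
  rewrite (@Rintegral_itv_cat _ b 0 v t)//; last first.
    apply: (@bounded_integrable_itv _ _ _ _ 1) => // x _.
    by rewrite /b; case: ifP; rewrite ?normr1 ?normr0.
  rewrite -(Rintegral_itv_obnd_cbnd (r := v)); last first.
    apply: integrableS (@bounded_integrable_itv _ b v t 1 mb _) => //.
      by apply: subset_itvr; rewrite bnd_simp.
    by move=> x _; rewrite /b; case: ifP; rewrite ?normr1 ?normr0.
  rewrite (@eq_Rintegral _ _ _ _ _ (cst 1)); last first.
    by move=> x; rewrite inE/= in_itv/= /b => ->.
  rewrite [X in _ + X](@eq_Rintegral _ _ _ _ _ (cst 0)); last first.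
    move=> x; rewrite inE/= in_itv/= /b => /andP[vx _].
    by rewrite [x <= v]leNgt vx andbF.
  rewrite !Rintegral_cst//= mul0r addr0 mul1r lebesgue_measure_itv/= lte_fin.
  by move: v0; rewrite le_eqVlt => /predU1P[<-|->]; rewrite ?ltxx//= subr0.
rewrite /pois expr0 fact0 divr1 mulr1 => <-; congr (P _).
apply/seteqP; split => w /=.
  move=> cl; exists [::]; split => // k; split => // -[/= h1 h2].
  by exfalso; apply: cl; split => //; exists k; rewrite h1.
move=> [s [_ /size0nil -> H]] [_ [j /andP[h1 h2]]].
by have [/(_ (conj h1 h2))] := H j.
Qed.

Lemma clear_mono w v v' : v' <= v -> clear w v -> clear w v'.
Proof.
move=> v'v H [? [j /andP[h1 h2]]]; apply: H; split => //.
by exists j; rewrite h1 (le_trans h2).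
Qed.

(** By [clear_mono] the clear lengths form an initial segment, and [a] is its supremum within
    [[0, t]]. Whether [a] itself is clear stays open, a single point being negligible under the
    integrals. *)
Lemma clear_age w : exists a, [/\ 0 <= a, a <= t,
  forall v, v < a -> clear w v & forall v, a < v -> v <= t -> ~ clear w v].
Proof.
pose A := [set v | [/\ 0 <= v, v <= t & clear w v]].
have ubA : has_ubound A by exists t => v [].
(* The set is empty when even length 0 is not clear, that is, when a catastrophe falls exactly at
   [t]. *)
have [A0|/nonemptyPn nA] := pselect (A !=set0); last first.
  exists 0; split => //.
    move=> v v0 [_ [j /andP[h1 h2]]].
    by move: (le_trans h1 h2); rewrite leNgt v0.
  move=> v v0 vt cl; have : A v by split => //; exact: ltW.
  by rewrite nA.
have [v0 Av0] := A0.
have a0 : 0 <= sup A.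
  by have [h _ _] := Av0; apply: le_trans h _; exact: (ub_le_sup ubA).
exists (sup A); split => //.
- by apply: ge_sup => // v [].
- move=> v /(sup_gt A0)[v' [_ _ cl] vv'].
  exact: clear_mono (ltW vv') cl.
- move=> v av vt cl; have : v <= sup A.
    by apply: (ub_le_sup ubA); split => //; apply: le_trans a0 (ltW av).
  by rewrite leNgt av.
Qed.

Definition clear_ind w v : R := \1_[set w | clear w v] w.

Let measurable_clear_ind d' (T : measurableType d') (g : T -> Omega) (f : T -> R) :
  (forall j, measurable_fun setT (Y j \o g)) -> measurable_fun setT f ->
  measurable_fun setT (fun x => clear_ind (g x) (f x)).
Proof.
move=> mg mf.
have -> : (fun x => clear_ind (g x) (f x)) = \1_[set x | clear (g x) (f x)].
  by apply/funext => x; exact: eq_indic.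
by apply: measurable_indic; exact: measurable_clear.
Qed.

Let measurable_clear_indr w : measurable_fun setT (clear_ind w).
Proof.
by apply: (@measurable_clear_ind _ _ (fun=> w) id) => // j; exact: measurable_cst.
Qed.

Let clear_ind_bounded w v : `|clear_ind w v| <= 1.
Proof. by rewrite /clear_ind indicE; case: (_ \in _); rewrite ?normr1 ?normr0. Qed.

Lemma Rintegral_clear_ind w a (h : R -> R) C : 0 <= a <= t ->
  (forall v, v < a -> clear w v) -> (forall v, a < v -> v <= t -> ~ clear w v) ->
  measurable_fun setT h -> (forall v, 0 <= v <= t -> `|h v| <= C) ->
  \int[mu]_(v in `[0, t]) (h v * clear_ind w v) = \int[mu]_(v in `[0, a]) h v.
Proof.
move=> /andP[a0 at_] cl ncl mh bh.
have mhc : measurable_fun setT (fun v => h v * clear_ind w v) by exact: measurable_funM.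
have C0 : 0 <= C by apply: le_trans (bh 0 _) => //; rewrite lexx.
have hci x y : 0 <= x -> y <= t ->
    mu.-integrable `[x, y] (EFin \o (fun v => h v * clear_ind w v)).
  move=> x0 yt; apply: (@bounded_integrable_itv _ _ _ _ C) => // v /andP[xv vy].
  rewrite normrM -[leRHS]mulr1 ler_pM// bh//.
  by rewrite (le_trans x0)//= (le_trans vy).
have hi : mu.-integrable `[0, a] (EFin \o h).
  apply: (@bounded_integrable_itv _ _ _ _ C) => // v /andP[v0 va].
  by rewrite bh// v0 (le_trans va).
rewrite (@Rintegral_itv_cat _ _ 0 a t)//; last exact: hci.
rewrite -(Rintegral_itv_obnd_cbnd (r := a)); last first.
  by apply: integrableS (hci a t a0 _) => //; apply: subset_itvr; rewrite bnd_simp.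
rewrite [X in _ + X](@eq_Rintegral _ _ _ _ _ (cst 0)); last first.
  move=> v; rewrite inE/= in_itv/= => /andP[av vt].
  by rewrite /clear_ind indicE memNset ?mulr0//; exact: ncl.
rewrite Rintegral_cst//= mul0r addr0.
rewrite -(Rintegral_itv_bndo_bndc (r := a)); last first.
  by apply: integrableS (hci 0 a _ _) => //; apply: subset_itvl; rewrite bnd_simp.
rewrite -(Rintegral_itv_bndo_bndc (r := a)); last first.
  by apply: integrableS hi => //; apply: subset_itvl; rewrite bnd_simp.
apply: eq_Rintegral => v; rewrite inE/= in_itv/= => /andP[v0 va].
by rewrite /clear_ind indicE mem_set ?mulr1//; exact: cl.
Qed.

Local Notation M := (thinned_mean lam survival).

Let clear_survival w v : R := survival v * clear_ind w v.

Let mean_clear w : R := thinned_mean lam (clear_survival w) t.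

Lemma prob_present_given w n :
  P [set w' | exists s : seq nat, [/\ uniq s, size s = n & forall k,
     (epoch X k w' <= t /\ t < epoch X k w' + S k w' /\
      clear w (t - epoch X k w')) <-> k \in s]] =
  (pois n (mean_clear w))%:E.
Proof.
pose D : set (R * R) :=
  [set x | 0 <= x.1] `&` ([set x | x.1 < x.2] `&` [set x | clear w x.1]).
have mD : measurable D.
  apply: measurableI; first exact: measurable_le_set.
  apply: measurableI; first exact: measurable_lt_set.
  by apply: (@measurable_clear _ _ _ _ _ _ _ (fun=> w) fst) => // j; exact: measurable_cst.
have mb : measurable_fun setT (clear_survival w).
  by apply: measurable_funM => //; exact: measurable_survival.
have bE k v : P [set w' | D (v, S k w')] = (clear_survival w v)%:E.
  rewrite /clear_survival /survival /clear_ind indicE; case: ifPn => v0; last first.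
    rewrite mul0r (_ : [set _ | _] = set0) ?measure0//.
    by apply/seteqP; split => // w' [/= h]; move: v0; rewrite h.
  have [cl|ncl] := pselect (clear w v); last first.
    rewrite memNset// mulr0 (_ : [set _ | _] = set0) ?measure0//.
    by apply/seteqP; split => // w' [_ [_ /=]].
  rewrite mem_set// mulr1 EFinB -(cdfS k v) -probability_setC//.
  congr (P _); apply/seteqP; split => w' /=.
    by move=> [_ [/= h _]]; apply/negP; rewrite -ltNge.
  by move=> /negP; rewrite -ltNge => h; split.
have bneg v : v < 0 -> clear_survival w v = 0.
  by move=> v0; rewrite /clear_survival survival_neg// mul0r.
rewrite -(thinning lam0 mX mS cdfX indep_arrival_service mD mb bE bneg).
congr (P _); apply/seteqP; split => w' [s [us ss sP]]; exists s; split => // k.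
  rewrite -(sP k) /D /=; split.
    by move=> [/= h1 [/= h2 h3]]; split; [rewrite -subr_ge0|split => //; rewrite -ltrBlDl].
  by move=> [h1 [h2 h3]]; split; [rewrite /= subr_ge0|split => //=; rewrite ltrBlDl].
rewrite -(sP k) /D /=; split.
  by move=> [h1 [h2 h3]]; split; [rewrite /= subr_ge0|split => //=; rewrite ltrBlDl].
by move=> [/= h1 [/= h2 h3]]; split; [rewrite -subr_ge0|split => //; rewrite -ltrBlDl].
Qed.

Lemma present_clear w k : present nu X Y S t w k <->
  (epoch X k w <= t /\ t < epoch X k w + S k w /\ clear w (t - epoch X k w)).
Proof.
rewrite /present /clear; split => -[h1 [h2 h3]]; do 2 split => //; apply: contra_not h3.
  move=> [nup [j /andP[h h']]]; split => //; exists j.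
  by rewrite -(subr_ge0 _ t) h andbT; lra.
move=> [nup [j /andP[h h']]]; split => //; exists j.
by rewrite subr_ge0 h'/= lerD2l lerN2.
Qed.

Let measurable_epoch_arrival k : measurable_fun setT (fun w => epoch X k w).
Proof. exact: (@measurable_epoch R _ _ Omega X id). Qed.

Lemma measurable_N_eq n : measurable (N_eq nu X Y S t n).
Proof.
apply: measurable_exact_set => k.
rewrite (_ : (fun w => present nu X Y S t w k) = [set w | epoch X k w <= t] `&`
   ([set w | t < epoch X k w + S k w] `&` [set w | clear w (t - epoch X k w)])); last first.
  by apply/seteqP; split => w /=; rewrite present_clear.
apply: measurableI; first exact: measurable_le_set.
apply: measurableI.
  by apply: measurable_lt_set => //; exact: measurable_funD.
apply: (@measurable_clear _ _ _ _ _ _ _ id) => //.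
exact: measurable_funB.
Qed.

(** Catastrophes use indices disjoint from those of arrivals and services, so [indep_fubini]
    separates the two roles of the sample point. *)
Lemma prob_N_eq n : P (N_eq nu X Y S t n) = (\int[P]_w (pois n (mean_clear w))%:E)%E.
Proof.
pose J := [pred k : nat + nat + nat | if k is inl (inr _) then true else false].
pose J' := [pred k : nat + nat + nat | if k is inl (inr _) then false else true].
have JJ' k : J k -> ~~ J' k by case: k => [[]|].
have mZ i : measurable_fun setT (pack3 X Y S i) by case: i => [[]|].
pose W := sub_space (pack3 X Y S) J; pose W' := sub_space (pack3 X Y S) J'.
pose Q k := [set x : W * W' | epoch X k (x.2 : Omega) <= t /\
  t < epoch X k (x.2 : Omega) + S k (x.2 : Omega) /\
  clear x.1 (t - epoch X k (x.2 : Omega))].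
have mX2 j : measurable_fun setT (fun x : W * W' => X j x.2).
  apply: (@measurableT_comp _ _ _ _ _ _ (X j : W' -> R) _ snd) => //.
  exact: (@measurable_sub_space _ _ _ _ (pack3 X Y S) J' (inl (inl j))).
have mS2 j : measurable_fun setT (fun x : W * W' => S j x.2).
  apply: (@measurableT_comp _ _ _ _ _ _ (S j : W' -> R) _ snd) => //.
  exact: (@measurable_sub_space _ _ _ _ (pack3 X Y S) J' (inr j)).
have mY1 j : measurable_fun setT (fun x : W * W' => Y j x.1).
  apply: (@measurableT_comp _ _ _ _ _ _ (Y j : W -> R) _ fst) => //.
  exact: (@measurable_sub_space _ _ _ _ (pack3 X Y S) J (inl (inr j))).
have mE k : measurable_fun setT (fun x : W * W' => epoch X k (x.2 : Omega)).
  exact: (@measurable_epoch R _ _ Omega X (snd : W * W' -> Omega)).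
have mQ k : measurable (Q k).
  apply: measurableI; first exact: measurable_le_set.
  apply: measurableI.
    by apply: measurable_lt_set => //; exact: measurable_funD.
  apply: (@measurable_clear _ _ _ _ _ _ _ (fst : W * W' -> Omega)) => //.
  exact: measurable_funB.
pose N := [set x : W * W' | exists s : seq nat,
    [/\ uniq s, size s = n & forall k, Q k x <-> k \in s]].
have mN : measurable N by exact: measurable_exact_set.
pose N' w := [set w' : Omega | N (w, w')].
have mX' k : measurable_fun setT (fun w => epoch X k w).
  exact: (@measurable_epoch R _ _ Omega X id).
have mN' w : measurable (N' w).
  apply: measurable_exact_set => k.
  apply: measurableI; first exact: measurable_le_set.
  apply: measurableI.
    by apply: measurable_lt_set => //; exact: measurable_funD.
  apply: (@measurable_clear _ _ _ _ _ _ _ (fun=> w)) => //.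
    by move=> j; exact: measurable_cst.
  exact: measurable_funB.
have NE w : N_eq nu X Y S t n w <-> N (w, w).
  split=> -[s [us ss sP]]; exists s; split => // k; rewrite -(sP k).
    by rewrite present_clear.
  by rewrite present_clear.
have mNeq := measurable_N_eq n.
transitivity (\int[P]_w (\1_N (w, w))%:E)%E.
  transitivity (\int[P]_w (\1_(N_eq nu X Y S t n) w)%:E)%E.
    by rewrite integral_indic ?setIT.
  by apply: eq_integral => w _; congr EFin; apply: eq_indic; exact: NE.
rewrite (@indep_fubini _ _ _ _ _ _ mZ indep J J' (fun x => (\1_N x)%:E)) //; last first.
  by apply/measurable_EFinP; exact: measurable_indic.
apply: eq_integral => w _; rewrite -prob_present_given.
transitivity (\int[P]_w' (\1_(N' w) w')%:E)%E.
  by apply: eq_integral => w' _; congr EFin; exact: eq_indic.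
by rewrite integral_indic ?setIT.
Qed.

Let M0 v : 0 <= M v. Proof. exact: thinned_mean_ge0 lam0 survival01 v. Qed.
Let mM : measurable_fun setT M.
Proof. exact: measurable_thinned_mean lam0 measurable_survival survival01. Qed.

(** The density of [pois n (M v)] in [v] is [gain - loss]. Both being nonnegative, they can be kept
    on opposite sides of an equation, which suits Tonelli and avoids subtraction in the extended
    reals. *)
Let gain n v : R := lam * survival v * pois_pred n (M v).
Let loss n v : R := lam * survival v * pois n (M v).

Let m_gain n : measurable_fun setT (gain n).
Proof.
apply: measurable_funM; first by apply: measurable_funM => //; exact: measurable_survival.
by apply: measurableT_comp => //; exact: measurable_pois_pred.
Qed.

Let m_loss n : measurable_fun setT (loss n).
Proof.
apply: measurable_funM; first by apply: measurable_funM => //; exact: measurable_survival.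
by apply: measurableT_comp => //; exact: measurable_pois.
Qed.

Let lam_survival v : 0 <= lam * survival v <= lam.
Proof.
have /andP[s0 s1] := survival01 v.
by rewrite mulr_ge0 ?(ltW lam0)//= ler_piMr ?(ltW lam0).
Qed.

Let gain_bounds n v : 0 <= gain n v <= lam.
Proof.
have /andP[s0 s1] := lam_survival v.
rewrite mulr_ge0 ?pois_pred_ge0//= -[leRHS]mulr1 ler_pM ?pois_pred_ge0//.
exact: pois_pred_le1.
Qed.

Let loss_bounds n v : 0 <= loss n v <= lam.
Proof.
have /andP[s0 s1] := lam_survival v.
by rewrite mulr_ge0 ?pois_ge0//= -[leRHS]mulr1 ler_pM ?pois_ge0// pois_le1.
Qed.

Let norm_gain n v : `|gain n v| <= lam.
Proof. by have /andP[? ?] := gain_bounds n v; rewrite ger0_norm. Qed.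

Let norm_loss n v : `|loss n v| <= lam.
Proof. by have /andP[? ?] := loss_bounds n v; rewrite ger0_norm. Qed.

(** On each path [mean_clear w] is [M] at the age [a], and [pois n (M a)] is its value at 0 plus the
    integral of [gain - loss] over [[0, a]]. Writing that integral with [clear_ind] removes [a], so
    averaging needs only [prob_clear]. *)
Let balance n w : pois n (mean_clear w) + \int[mu]_(v in `[0, t]) (loss n v * clear_ind w v)
  = (n == 0%N)%:R + \int[mu]_(v in `[0, t]) (gain n v * clear_ind w v).
Proof.
have [a [a0 at_ cl ncl]] := clear_age w.
have a0t : 0 <= a <= t by rewrite a0.
have -> : mean_clear w = M a.
  rewrite /mean_clear /thinned_mean; congr (_ * _).
  apply: (@Rintegral_clear_ind _ _ _ 1) => //; first exact: measurable_survival.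
  by move=> v _; have /andP[? ?] := survival01 v; rewrite ger0_norm.
rewrite (@Rintegral_clear_ind _ a (loss n) lam)// (@Rintegral_clear_ind _ a (gain n) lam)//.
have iM := indef_integral_thinned_mean lam0 measurable_survival survival01 a.
have [_ _ _ WE] := indef_integral_pois n iM (fun x _ => M0 x).
have e : \int[mu]_(v in `[0, a]) (dpois n (M v) * (lam * survival v)) =
    \int[mu]_(v in `[0, a]) (gain n v - loss n v).
  by apply: eq_Rintegral => v _; rewrite /gain /loss /dpois; ring.
have := WE 0 a (lexx _) a0 (lexx _).
rewrite /= (thinned_mean_neg _ _ (lexx 0)) pois0 e RintegralB//.
- by move=> /eqP; rewrite subr_eq => /eqP ->; ring.
- exact: (@bounded_integrable_itv _ _ _ _ lam).
- exact: (@bounded_integrable_itv _ _ _ _ lam).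
Qed.

(** The restriction to [[0, t]] is moved into the integrand, so that Tonelli applies on the whole
    product space. *)
Let clear_integrand (g : R -> R) (x : Omega * R) : \bar R :=
  (g x.2 * clear_ind x.1 x.2 * \1_`[0, t] x.2)%:E.

Let clear_integrandE (g : R -> R) w :
  (\int[mu]_(v in `[0%R, t]) (g v * clear_ind w v)%:E =
   \int[mu]_v clear_integrand g (w, v))%E.
Proof.
rewrite integral_mkcond; apply: eq_integral => v _.
by rewrite patchE /clear_integrand /= indicE; case: ifP => _; rewrite ?mulr1 ?mulr0.
Qed.

Let measurable_clear_integrand (g : R -> R) : measurable_fun setT g ->
  measurable_fun setT (clear_integrand g).
Proof.
move=> mg; apply/measurable_EFinP; apply: measurable_funM; last first.
  by apply: measurableT_comp => //; exact: measurable_indic.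
apply: measurable_funM; first exact: measurableT_comp.
by apply: (@measurable_clear_ind _ _ fst snd) => // j; exact: measurableT_comp.
Qed.

Let clear_integrand_ge0 (g : R -> R) x : (forall v, 0 <= g v) ->
  (0 <= clear_integrand g x)%E.
Proof.
by move=> g0; rewrite lee_fin /clear_ind !indicE !mulr_ge0.
Qed.

Lemma integral_clear (g : R -> R) : measurable_fun setT g -> (forall v, 0 <= g v) ->
  (\int[P]_w \int[mu]_(v in `[0%R, t]) (g v * clear_ind w v)%:E =
   \int[mu]_(v in `[0%R, t]) (g v * expR (- (nu * v)))%:E)%E.
Proof.
move=> mg g0; under eq_integral do rewrite clear_integrandE.
transitivity (\int[mu]_v \int[P]_w clear_integrand g (w, v))%E.
  exact: (@fubini_tonelli _ _ _ _ _ P mu _ (measurable_clear_integrand mg)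
    (fun x => clear_integrand_ge0 x g0)).
rewrite [RHS]integral_mkcond; apply: eq_integral => v _.
rewrite patchE /clear_integrand /= indicE; case: ifPn => vt; last first.
  by apply: integral0_eq => w _; rewrite mulr0.
move: vt; rewrite inE/= in_itv/= => vt.
under eq_integral do rewrite mulr1 EFinM.
have mc : measurable [set w | clear w v].
  by apply: (@measurable_clear _ _ _ _ _ _ _ id (fun=> v)).
rewrite ge0_integralZl//=; first last.
- by rewrite lee_fin.
- by move=> w _; rewrite lee_fin /clear_ind indicE.
- by apply/measurable_EFinP; apply: (@measurable_clear_ind _ _ id (fun=> v)).
rewrite EFinM -prob_clear//; congr (_ * _)%E.
transitivity (\int[P]_w (\1_[set w | clear w v] w)%:E)%E => //.
by rewrite integral_indic ?setIT.
Qed.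

Let m_integral_clear (g : R -> R) : measurable_fun setT g -> (forall v, 0 <= g v) ->
  measurable_fun setT (fun w => \int[mu]_(v in `[0%R, t]) (g v * clear_ind w v)%:E)%E.
Proof.
move=> mg g0.
rewrite (_ : (fun _ => _) = (fun w => \int[mu]_v clear_integrand g (w, v))%E).
  exact: (measurable_fun_fubini_tonelli_F (m2 := mu) _
    (measurable_clear_integrand mg) (fun x => clear_integrand_ge0 x g0)).
by apply/funext => w; exact: clear_integrandE.
Qed.

Let exp_le1 v : 0 <= v -> `|expR (- (nu * v))| <= 1.
Proof.
by move=> v0; rewrite ger0_norm ?expR_ge0// -expR0 ler_expR oppr_le0 mulr_ge0.
Qed.

Let mexp : measurable_fun setT (fun v : R => expR (- (nu * v))).
Proof.
apply: measurableT_comp; first exact: measurable_expR.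
by apply: measurable_funN; exact: measurable_funM.
Qed.

Let EFin_Rintegral (h : R -> R) C : measurable_fun setT h ->
  (forall v, 0 <= v <= t -> `|h v| <= C) ->
  (\int[mu]_(v in `[0%R, t]) (h v)%:E = (\int[mu]_(v in `[0%R, t]) h v)%R%:E)%E.
Proof.
move=> mh bh; rewrite /Rintegral fineK//; apply: integrable_fin_num => //.
exact: (@bounded_integrable_itv _ _ _ _ C).
Qed.

Let balanceE n w : ((pois n (mean_clear w))%:E +
    \int[mu]_(v in `[0%R, t]) (loss n v * clear_ind w v)%:E =
  (n == 0%N)%:R%:E + \int[mu]_(v in `[0%R, t]) (gain n v * clear_ind w v)%:E)%E.
Proof.
rewrite !(@EFin_Rintegral _ lam).
- by rewrite -!EFinD balance.
- exact: measurable_funM.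
- by move=> v _; rewrite normrM -[leRHS]mulr1 ler_pM.
- exact: measurable_funM.
- by move=> v _; rewrite normrM -[leRHS]mulr1 ler_pM.
Qed.

Let measurable_mean_clear : measurable_fun setT mean_clear.
Proof.
have h0 v : 0 <= survival v by have /andP[] := survival01 v.
apply: measurable_funM => //.
exact: (measurableT_comp (@fine_measurable R _ measurableT)
  (m_integral_clear measurable_survival h0)).
Qed.

(** Averaging [balance] replaces [clear_ind] by [expR (- (nu * v))]. Integrating the density of
    [expR (- (nu * v)) * pois n (M v)] over [[0, t]] then trades the gain and loss integrals for the
    boundary term at [t] and the integral weighted by [nu]. *)
Lemma prob_N_eq_formula n : P (N_eq nu X Y S t n) =
  (expR (- (nu * t)) * pois n (M t) +
   nu * \int[mu]_(v in `[0, t]) (expR (- (nu * v)) * pois n (M v)))%:E.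
Proof.
have g0 v : 0 <= gain n v by have /andP[] := gain_bounds n v.
have l0 v : 0 <= loss n v by have /andP[] := loss_bounds n v.
have mc0 w : 0 <= mean_clear w.
  apply: thinned_mean_ge0 lam0 _ _ => v; rewrite /clear_survival.
  have /andP[s0 s1] := survival01 v.
  rewrite /clear_ind indicE; case: (_ \in _); rewrite ?mulr1 ?mulr0 ?lexx ?ler01//.
  by rewrite s0.
have ig0 (h : R -> R) w : (forall v, 0 <= h v) ->
    (0 <= \int[mu]_(v in `[0%R, t]) (h v * clear_ind w v)%:E)%E.
  by move=> h0; apply: integral_ge0 => v _; rewrite lee_fin /clear_ind indicE mulr_ge0.
have eq1 : (P (N_eq nu X Y S t n) +
    \int[mu]_(v in `[0%R, t]) (loss n v * expR (- (nu * v)))%:E =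
    (n == 0%N)%:R%:E + \int[mu]_(v in `[0%R, t]) (gain n v * expR (- (nu * v)))%:E)%E.
  rewrite prob_N_eq -(integral_clear (m_loss n) l0) -(integral_clear (m_gain n) g0).
  rewrite -ge0_integralD//; first last.
  - exact: m_integral_clear.
  - by move=> w _; exact: ig0.
  - by apply/measurable_EFinP; apply: measurableT_comp => //; exact: measurable_pois.
  - by move=> w _; rewrite lee_fin pois_ge0.
  have <- : (\int[P]_w (n == 0%N)%:R%:E = (n == 0%N)%:R%:E)%E.
    by rewrite integral_cst//= probability_setT mule1.
  rewrite -ge0_integralD//; first last.
  - exact: m_integral_clear.
  - by move=> w _; exact: ig0.
  by apply: eq_integral => w _; exact: balanceE.
have bl v : 0 <= v <= t -> `|loss n v * expR (- (nu * v))| <= lam.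
  by move=> /andP[v0 _]; rewrite normrM -[leRHS]mulr1 ler_pM// exp_le1.
have bg v : 0 <= v <= t -> `|gain n v * expR (- (nu * v))| <= lam.
  by move=> /andP[v0 _]; rewrite normrM -[leRHS]mulr1 ler_pM// exp_le1.
have mlE : measurable_fun setT (fun v => loss n v * expR (- (nu * v))) by exact: measurable_funM.
have mgE : measurable_fun setT (fun v => gain n v * expR (- (nu * v))) by exact: measurable_funM.
move: eq1; rewrite (EFin_Rintegral mlE bl) (EFin_Rintegral mgE bg).
have Pfin : P (N_eq nu X Y S t n) \is a fin_num.
  by apply: fin_num_measure; exact: measurable_N_eq.
rewrite -(fineK Pfin) -!EFinD => -[eq2]; congr EFin.
have iM := indef_integral_thinned_mean lam0 measurable_survival survival01 t.
have iP := indef_integral_pois n iM (fun x _ => M0 x).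
(* Again the exponential is [pois 0] of an affine function, written in the shape [p + q * v] of
   [indef_integral_affine]. *)
have iE : indef_integral 0 t (pois 0 \o (fun v => 0 + nu * v))
    (fun v => dpois 0 (0 + nu * v) * nu).
  apply: indef_integral_pois; first exact: indef_integral_affine.
  by move=> v /andP[v0 _]; rewrite add0r mulr_ge0.
have [_ _ _ WE] := indef_integral_mul iE iP.
have := WE 0 t (lexx _) t0 (lexx _).
have mpE : measurable_fun setT (fun v => expR (- (nu * v)) * pois n (M v)).
  by apply: measurable_funM => //; apply: measurableT_comp => //; exact: measurable_pois.
have e : \int[mu]_(v in `[0, t]) (dpois 0 (0 + nu * v) * nu * (pois n \o M) v +
     (pois 0 \o (fun v => 0 + nu * v)) v * (dpois n (M v) * (lam * survival v))) =
  \int[mu]_(v in `[0, t]) (gain n v * expR (- (nu * v)) - loss n v * expR (- (nu * v)) -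
     nu * (expR (- (nu * v)) * pois n (M v))).
  apply: eq_Rintegral => v _.
  rewrite /= /dpois [pois_pred 0 _]/= !pois_exp !add0r /gain /loss; ring.
have bp v : 0 <= v <= t -> `|expR (- (nu * v)) * pois n (M v)| <= 1.
  move=> /andP[v0 _]; rewrite normrM -[leRHS]mulr1 ler_pM ?exp_le1//.
  by rewrite ger0_norm ?pois_ge0 ?pois_le1.
have ip : mu.-integrable `[0, t] (EFin \o (fun v => expR (- (nu * v)) * pois n (M v))).
  exact: (@bounded_integrable_itv _ _ _ _ 1).
have il : mu.-integrable `[0, t] (EFin \o (fun v => loss n v * expR (- (nu * v)))).
  exact: (@bounded_integrable_itv _ _ _ _ lam).
have ig : mu.-integrable `[0, t] (EFin \o (fun v => gain n v * expR (- (nu * v)))).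
  exact: (@bounded_integrable_itv _ _ _ _ lam).
have inp : mu.-integrable `[0, t] (EFin \o (fun v => nu * (expR (- (nu * v)) * pois n (M v)))).
  apply: (@bounded_integrable_itv _ _ _ _ nu); first exact: measurable_funM.
  by move=> v /bp h; rewrite normrM ger0_norm// ler_piMr.
have igl : mu.-integrable `[0, t] (EFin \o (fun v =>
    gain n v * expR (- (nu * v)) - loss n v * expR (- (nu * v)))).
  apply: (@bounded_integrable_itv _ _ _ _ (lam + lam)); first exact: measurable_funB.
  by move=> v vt; rewrite (le_trans (ler_normB _ _))// lerD ?bg ?bl.
rewrite e RintegralB// RintegralB// RintegralZl//.
rewrite /= !add0r mulr0 !pois0 (thinned_mean_neg _ _ (lexx 0)) pois0 pois_exp eqxx mul1r.
by move=> h; lra.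
Qed.

End catastrophes.

Local Open Scope complex_scope.

(** * Averaging over the age and passage to the limit of the series *)

Section mixture.
Context (R : realType).
Local Notation mu := (@lebesgue_measure R).
Variables (nu t : R) (M : R -> R).
Hypothesis nu0 : 0 <= nu.
Hypothesis t0 : 0 <= t.
Hypothesis mM : measurable_fun setT M.
Hypothesis M0t : forall v, 0 <= v <= t -> 0 <= M v <= M t.

(* Expectation of [h (M age)], the age being exponential of rate [nu] cut off
   at [t]. *)
Definition age_mean (h : R -> R) : R :=
  expR (- (nu * t)) * h (M t) +
  nu * \int[mu]_(v in `[0, t]) (expR (- (nu * v)) * h (M v)).

Let e01 v : 0 <= v -> 0 <= expR (- (nu * v)) <= 1.
Proof.
by move=> v0; rewrite expR_ge0 -expR0 ler_expR oppr_le0 mulr_ge0.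
Qed.

Let mhM (h : R -> R) : measurable_fun setT h ->
  measurable_fun setT (fun v => expR (- (nu * v)) * h (M v)).
Proof.
move=> mh; apply: measurable_funM; last exact: measurableT_comp.
apply: measurableT_comp; first exact: measurable_expR.
by apply: measurable_funN; exact: measurable_funM.
Qed.

Let bhM (h : R -> R) C : (forall x, 0 <= x <= M t -> `|h x| <= C) ->
  forall v, 0 <= v <= t -> `|expR (- (nu * v)) * h (M v)| <= C.
Proof.
move=> bh v vt; have /andP[v0 _] := vt; have /andP[e0 e1] := e01 v0.
rewrite normrM -[leRHS]mul1r ler_pM// ?bh ?M0t//.
by rewrite ger0_norm.
Qed.

Let ihM (h : R -> R) C : measurable_fun setT h ->
  (forall x, 0 <= x <= M t -> `|h x| <= C) ->
  mu.-integrable `[0, t] (EFin \o (fun v => expR (- (nu * v)) * h (M v))).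
Proof.
by move=> mh bh; apply: (@bounded_integrable_itv _ _ _ _ C);
  [exact: mhM|exact: bhM].
Qed.

(** The shape [h + c * g] serves both for adding one term to a partial sum and, with [c = -1], for
    comparing two functions. *)
Lemma age_mean_lin (h g : R -> R) c C C' :
  measurable_fun setT h -> (forall x, 0 <= x <= M t -> `|h x| <= C) ->
  measurable_fun setT g -> (forall x, 0 <= x <= M t -> `|g x| <= C') ->
  age_mean (fun x => h x + c * g x) = age_mean h + c * age_mean g.
Proof.
move=> mh bh mg bg; rewrite /age_mean.
have -> : \int[mu]_(v in `[0, t]) (expR (- (nu * v)) * (h (M v) + c * g (M v))) =
  \int[mu]_(v in `[0, t]) (expR (- (nu * v)) * h (M v)) +
  c * \int[mu]_(v in `[0, t]) (expR (- (nu * v)) * g (M v)).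
  have ih := ihM mh bh; have ig := ihM mg bg.
  rewrite -RintegralZl// -RintegralD//.
    by apply: eq_Rintegral => v _; ring.
  apply: (@bounded_integrable_itv _ _ _ _ (`|c| * C')).
    by apply: measurable_funM => //; exact: mhM.
  by move=> v vt; rewrite normrM ler_wpM2l// (bhM bg).
ring.
Qed.

Lemma age_mean_sum_pois (c : nat -> R) m :
  \sum_(n < m) c n * age_mean (pois n) = age_mean (fun x => \sum_(n < m) c n * pois n x).
Proof.
have bpois n x : 0 <= x <= M t -> `|pois n x| <= (1 : R).
  by move=> /andP[x0 _]; rewrite ger0_norm ?pois_ge0 ?pois_le1.
have msum k : measurable_fun setT (fun x => \sum_(n < k) c n * pois n x).
  by apply: measurable_sum => n; apply: measurable_funM => //; exact: measurable_pois.
have bsum k x : 0 <= x <= M t -> `|\sum_(n < k) c n * pois n x| <= \sum_(n < k) `|c n|.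
  move=> xM; rewrite (le_trans (ler_norm_sum _ _ _))// ler_sum// => n _.
  by rewrite normrM ler_piMr// bpois.
elim: m => [|m IH].
  rewrite big_ord0 /age_mean.
  under eq_Rintegral do rewrite big_ord0 mulr0.
  by rewrite big_ord0 Rintegral_cst//= mul0r !mulr0 addr0.
rewrite big_ord_recr/= IH -(age_mean_lin _ (msum m) (bsum m) (measurable_pois m) (bpois m)).
by congr age_mean; apply/funext => x; rewrite big_ord_recr.
Qed.

(** The factor [1 + nu * t] comes from bounding both exponentials by 1; a crude bound on the total
    weight suffices because [e] tends to 0 in the application. *)
Lemma age_mean_near (h g : R -> R) e C C' :
  measurable_fun setT h -> (forall x, 0 <= x <= M t -> `|h x| <= C) ->
  measurable_fun setT g -> (forall x, 0 <= x <= M t -> `|g x| <= C') ->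
  (forall x, 0 <= x <= M t -> `|h x - g x| <= e) ->
  `|age_mean h - age_mean g| <= (1 + nu * t) * e.
Proof.
move=> mh bh mg bg hg.
have := age_mean_lin (-1) mh bh mg bg; rewrite mulN1r => <-.
have mhg : measurable_fun setT (fun x => h x + -1 * g x).
  by apply: measurable_funD => //; exact: measurable_funM.
have bhg x : 0 <= x <= M t -> `|h x + -1 * g x| <= e by rewrite mulN1r; exact: hg.
rewrite mulrDl mul1r /age_mean (le_trans (ler_normD _ _))// lerD//.
  by apply: (bhM bhg); rewrite t0 lexx.
rewrite normrM ger0_norm// -mulrA ler_wpM2l// mulrC -[X in _ * X]subr0.
by apply: norm_Rintegral_le => //; [exact: (mhM mhg)|exact: (bhM bhg)].
Qed.

Lemma cvg_age_mean (c : nat -> R) (g : R -> R) (err : nat -> R) :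
  measurable_fun setT g -> (exists C, forall x, 0 <= x <= M t -> `|g x| <= C) ->
  (forall m x, 0 <= x <= M t -> `|\sum_(n < m) c n * pois n x - g x| <= err m) ->
  err m @[m --> \oo] --> 0 ->
  (fun m => \sum_(n < m) c n * age_mean (pois n)) @ \oo --> age_mean g.
Proof.
move=> mg [C bg] near err0.
have near' m : `|age_mean g - \sum_(n < m) c n * age_mean (pois n)| <= (1 + nu * t) * err m.
  rewrite age_mean_sum_pois distrC.
  apply: (@age_mean_near _ _ _ (\sum_(n < m) `|c n|) C) => //.
  - by apply: measurable_sum => n; apply: measurable_funM => //; exact: measurable_pois.
  - move=> x /andP[x0 _]; rewrite (le_trans (ler_norm_sum _ _ _))// ler_sum// => n _.
    by rewrite normrM ler_piMr// ger0_norm ?pois_ge0 ?pois_le1.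
  - exact: near.
have : (1 + nu * t) * err m @[m --> \oo] --> 0.
  by rewrite -(mulr0 (1 + nu * t)); exact: cvgMr.
move=> /cvgrPdist_le H; apply/cvgrPdist_le => e e0.
near=> m; apply: le_trans (near' m) _.
have : `|0 - (1 + nu * t) * err m| <= e by near: m; exact: H.
by rewrite sub0r normrN; apply: le_trans; exact: ler_norm.
Unshelve. all: by end_near. Qed.

End mixture.

(** * Real and imaginary parts of the formula, and the generating function *)

Section complex_parts.
Context (R : realType).
Implicit Types (z w : R[i]).

Lemma cre_add z w : cre (z + w) = cre z + cre w. Proof. by case: z; case: w. Qed.
Lemma cim_add z w : cim (z + w) = cim z + cim w. Proof. by case: z; case: w. Qed.
Lemma cre_mul z w : cre (z * w) = cre z * cre w - cim z * cim w.
Proof. by case: z; case: w. Qed.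
Lemma cim_mul z w : cim (z * w) = cre z * cim w + cim z * cre w.
Proof. by case: z; case: w. Qed.

Lemma norm_parts_le1 z : `|z| <= 1 -> `|cre z| <= 1 /\ `|cim z| <= 1.
Proof.
case: z => a b; rewrite normc_def /= lecR => h.
have h2 : a ^+ 2 + b ^+ 2 <= 1.
  have ab0 : 0 <= a ^+ 2 + b ^+ 2 by rewrite addr_ge0 ?sqr_ge0.
  by rewrite -[leLHS]sqr_sqrtr// expr_le1// sqrtr_ge0.
have := sqr_ge0 a; have := sqr_ge0 b => b0 a0.
split; rewrite -(@expr_le1 _ 2)// real_normK ?num_real//; lra.
Qed.

Variables (lam nu : R) (B : R -> R) (z : R[i]).

Let m u := lam * Rintegral lebesgue_measure `[0, u] (fun x => 1 - B x).

(** Splitting off [expR (- (nu * u))] exhibits the integrand of [age_mean] at the function to which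
    the Poisson sums converge. *)
Lemma cre_cexp_expo u : cre (cexp (expo lam nu B z u)) =
  expR (- (nu * u)) * (expR (- ((1 - cre z) * m u)) * cos (cim z * m u)).
Proof.
rewrite /expo -/(m u); case: z => a b /=; rewrite mulrA -expRD.
by congr (expR _ * cos _); ring.
Qed.

Lemma cim_cexp_expo u : cim (cexp (expo lam nu B z u)) =
  expR (- (nu * u)) * (expR (- ((1 - cre z) * m u)) * sin (cim z * m u)).
Proof.
rewrite /expo -/(m u); case: z => a b /=; rewrite mulrA -expRD.
by congr (expR _ * sin _); ring.
Qed.

End complex_parts.

Theorem theorem2 (R : realType) (d : measure_display) (Omega : measurableType d)
  (P : probability Omega R) (lam nu : R) (B : R -> R)
  (X Y S : nat -> Omega -> R) :
  0 < lam -> 0 <= nu ->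
  (* B is a distribution function on [0, +oo) *)
  (forall x : R, x < 0 -> B x = 0) ->
  (* all interarrival / service times are random variables *)
  (forall k, measurable_fun setT (X k)) ->
  (forall k, measurable_fun setT (Y k)) ->
  (forall k, measurable_fun setT (S k)) ->
  (* customer interarrival times ~ Exp(lam) *)
  (forall k (x : R), P [set w | X k w <= x] =
     (if 0 <= x then 1 - expR (- (lam * x)) else 0)%:E) ->
  (* catastrophe interarrival times ~ Exp(nu) (there are no catastrophes if nu = 0) *)
  (0 < nu -> forall k (x : R), P [set w | Y k w <= x] =
     (if 0 <= x then 1 - expR (- (nu * x)) else 0)%:E) ->
  (* service times have distribution function B ... *)
  (forall k (x : R), P [set w | S k w <= x] = (B x)%:E) ->
  (* ... with finite mean b1 *)
  P.-integrable setT (EFin \o S 0%N) ->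
  (* all these random variables are mutually independent *)
  mutually_independent P (pack3 X Y S) ->
  forall (t : R) (z : R[i]), 0 <= t -> `|z| <= 1 ->
    (fun m => \sum_(n < m) cre (z ^+ n) * fine (P (N_eq nu X Y S t n)))
      @ \oo --> cre (pgf_formula lam nu B z t)
    /\
    (fun m => \sum_(n < m) cim (z ^+ n) * fine (P (N_eq nu X Y S t n)))
      @ \oo --> cim (pgf_formula lam nu B z t).
Proof.
move=> lam0 nu0 _ mX mY mS cdfX cdfY cdfS _ indep t z t0 z1.
have [a1 b1] := norm_parts_le1 z1.
pose sv := survival B; pose M := thinned_mean lam sv.
have msv : measurable_fun setT sv by exact: measurable_survival cdfS.
have sv01 : forall v, 0 <= sv v <= 1 by exact: survival01 mS cdfS.
have mM : measurable_fun setT M by exact: measurable_thinned_mean.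
have M0 v : 0 <= M v by exact: thinned_mean_ge0.
(* On [[0, u]] the cut in [survival] is inactive. *)
have ME u : 0 <= u -> M u = lam * Rintegral lebesgue_measure `[0, u] (fun x => 1 - B x).
  move=> u0; rewrite /M /thinned_mean; congr (_ * _).
  apply: eq_Rintegral => x; rewrite inE/= in_itv/= => /andP[x0 _].
  by rewrite /sv /survival x0.
have M0t v : 0 <= v <= t -> 0 <= M v <= M t.
  move=> /andP[v0 vt]; rewrite M0/=; exact: thinned_mean_le.
have pE n : fine (P (N_eq nu X Y S t n)) = age_mean nu t M (pois n).
  by rewrite (prob_N_eq_formula lam0 nu0 mX mY mS cdfX cdfY cdfS indep t0).
have mexp (c : R) : measurable_fun setT (fun x : R => expR (- (c * x))).
  apply: measurableT_comp; first exact: measurable_expR.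
  by apply: measurable_funN; exact: measurable_funM.
have mcos (c : R) : measurable_fun setT (fun x : R => cos (c * x)).
  apply: measurableT_comp; last exact: measurable_funM.
  by apply: continuous_measurable_fun; exact: continuous_cos.
have msin (c : R) : measurable_fun setT (fun x : R => sin (c * x)).
  apply: measurableT_comp; last exact: measurable_funM.
  by apply: continuous_measurable_fun; exact: continuous_sin.
have ebound (x : R) : 0 <= x -> `|expR (- ((1 - cre z) * x))| <= 1.
  move=> x0; rewrite ger0_norm ?expR_ge0// -[leRHS]expR0 ler_expR oppr_le0 mulr_ge0//.
  by rewrite subr_ge0; exact: le_trans (ler_norm _) a1.
have zr0 : cre (z ^+ 0) = 1 by rewrite expr0.
have zi0 : cim (z ^+ 0) = 0 by rewrite expr0.
have zrS n : cre (z ^+ n.+1) = cre z * cre (z ^+ n) - cim z * cim (z ^+ n).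
  by rewrite exprS cre_mul.
have ziS n : cim (z ^+ n.+1) = cre z * cim (z ^+ n) + cim z * cre (z ^+ n).
  by rewrite exprS cim_mul.
(* All means [M v] with [v] in [[0, t]] lie in [[0, M t]], so a single error sequence at [V = M t]
   serves for every age. *)
have near m x := @sum_pois_near _ _ _ a1 b1 _ _ zr0 zi0 zrS ziS (M t) m x.
split.
- under eq_fun do under eq_bigr do rewrite pE.
  have -> : cre (pgf_formula lam nu B z t) = age_mean nu t M
      (fun x => expR (- ((1 - cre z) * x)) * cos (cim z * x)).
    rewrite /pgf_formula cre_add cre_cexp_expo -ME// cre_mul /age_mean /= mul0r subr0.
    congr (_ + _ * _); apply: eq_Rintegral => u; rewrite inE/= in_itv/= => /andP[u0 _].
    by rewrite [LHS]cre_cexp_expo -ME.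
  apply: (@cvg_age_mean _ _ _ _ nu0 t0 mM M0t (fun n => cre (z ^+ n)) _
    (pois_error (M t)) _ _ _ (cvg_pois_error (M t))) => //.
  + exact: measurable_funM.
  + exists 1 => x /andP[x0 _]; rewrite normrM -[leRHS]mulr1 ler_pM ?ebound//.
    by rewrite ler_norml cos_geN1 cos_le1.
  + by move=> m x /(near m)[].
- under eq_fun do under eq_bigr do rewrite pE.
  have -> : cim (pgf_formula lam nu B z t) = age_mean nu t M
      (fun x => expR (- ((1 - cre z) * x)) * sin (cim z * x)).
    rewrite /pgf_formula cim_add cim_cexp_expo -ME// cim_mul /age_mean /= mul0r addr0.
    congr (_ + _ * _); apply: eq_Rintegral => u; rewrite inE/= in_itv/= => /andP[u0 _].
    by rewrite [LHS]cim_cexp_expo -ME.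
  apply: (@cvg_age_mean _ _ _ _ nu0 t0 mM M0t (fun n => cim (z ^+ n)) _
    (pois_error (M t)) _ _ _ (cvg_pois_error (M t))) => //.
  + exact: measurable_funM.
  + exists 1 => x /andP[x0 _]; rewrite normrM -[leRHS]mulr1 ler_pM ?ebound//.
    by rewrite ler_norml sin_geN1 sin_le1.
  + by move=> m x /(near m)[].
Qed.
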